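(* Assume that $\mathbb{P}(\eta>x)\sim l(x)$ as $x\to\infty$ for some slowly varying (at infinity) function $l$, and let $\tilde S(t)=\tilde S(\lfloor t\rfloor)$ for real $t\ge0$. Then the sequence of processes $$\Big(\frac{\tilde S(nt)}{\sqrt n},\ t\in[0,1]\Big)_{n\ge1}$$ has no weak limit in $D[0,1]$ as $n\to\infty$. Moreover, for every $t>0$, $$\max_{0\le s\le t}\frac{\tilde S(ns)}{\sqrt n}\to\infty\quad\text{in probability as } n\to\infty,$$ i.e. for every $c>0$, $\mathbb{P}\big(\max_{0\le s\le t}\tilde S(ns)/\sqrt n\ge c\big)\to1$ as $n\to\infty$.
   Context: Let $\{\xi_n\}_{n\ge1}$ be i.i.d. real random variables with generic copy $\xi$, $\mathbb{E}\xi=0$, $\mathbb{E}\xi^2=\sigma^2\in(0,\infty)$. Let $\{\eta_n\}_{n\ge1}$ be (strictly) positive i.i.d. random variables with generic copy $\eta$, independent of $\{\xi_n\}_{n\ge1}$. The random walk $\tilde S$ is defined by $\tilde S(0)=0$ and, for integers $n\ge 0$, $$\tilde S(n+1)=\begin{cases}\tilde S(n)+\xi_{n+1}, & \tilde S(n)>0,\\ \tilde S(n)+\eta_{n+1}, & \tilde S(n)\le 0.\end{cases}$$ A function $l$ is slowly varying if it is positive and measurable on some neighbourhood of infinity and $l(\lambda x)/l(x)\to1$ as $x\to\infty$ for every $\lambda>0$. $D[0,1]$ is the Skorokhod space of càdlàg functions on $[0,1]$. *)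

(* Defs.v *)
From HB Require Import structures.
From mathcomp Require Import all_boot all_order all_algebra finmap.
From mathcomp Require Import all_classical all_reals all_analysis.
From mathcomp Require Import lra.

Set Implicit Arguments.
Unset Strict Implicit.
Unset Printing Implicit Defensive.

Import Order.TTheory GRing.Theory Num.Theory.
Import numFieldNormedType.Exports.

Local Open Scope classical_set_scope.
Local Open Scope ring_scope.

Section independence.
Context {R : realType} {d : measure_display} {T : measurableType d}
  {P : probability T R}.
Implicit Types X Y : nat -> {RV P >-> R}.

Definition mutually_independent X : Prop :=
  forall (J : {fset nat}) (B : nat -> set R), (forall i, measurable (B i)) ->
  P (\bigcap_(i in [set` J]) X i @^-1` B i) =
    (\prod_(i <- J) P (X i @^-1` B i))%E.

Definition iid X : Prop :=
  mutually_independent X /\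
  forall n, distribution P (X n) = distribution P (X 0%N) :> (set R -> \bar R).

Definition generated_sigma_algebra X : set (set T) :=
  <<s \bigcup_i preimage_set_system setT (X i) measurable >>.

Definition independent_sequences X Y : Prop :=
  forall A B, generated_sigma_algebra X A -> generated_sigma_algebra Y B ->
  (P (A `&` B) = P A * P B)%E.

End independence.

Definition slowly_varying {R : realType} (l : R -> R) : Prop :=
  (exists a : R, (forall x, a < x -> 0 < l x) /\ measurable_fun `]a, +oo[ l) /\
  forall lambda : R, 0 < lambda -> l (lambda * x) / l x @[x --> +oo] --> (1 : R).

(* Convergence in distribution of random elements of a topological space to a
   Borel probability measure. *)
Definition converges_weakly {R : realType} {d : measure_display}
    {T : measurableType d} (P : probability T R) {E : ptopologicalType}
    (X : nat -> T -> E)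
    (mu : probability (g_sigma_algebraType (@open E)) R) : Prop :=
  forall f : E -> R, continuous f -> (exists M : R, forall x, `|f x| <= M) ->
  'E_P[fun w => f (X n w)]%E @[n --> \oo] --> (\int[mu]_x (f x)%:E)%E.

Section skorokhod.
Context (R : realType).

Definition unit_itv : Type := set_type (`[0, 1]%classic : set R).

HB.instance Definition _ := PseudoMetric.on unit_itv.

(* At t = 0 the left filter is the improper one, so that no condition is
   imposed there; at t = 1 right continuity is automatic. *)
Definition cadlag (x : unit_itv -> R) : Prop := forall t : unit_itv,
  (x s @[s --> within [set s | val t <= val s] (nbhs t)] --> x t) /\
  (exists l : R, x s @[s --> within [set s | val s < val t] (nbhs t)] --> l).

Record D01 : Type := MkD01 { D01_fun :> unit_itv -> R ; D01P : cadlag D01_fun }.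

Definition time_change (lam : unit_itv -> unit_itv) : Prop :=
  [/\ forall s t, val s < val t -> val (lam s) < val (lam t),
      continuous lam &
      forall t, exists s, lam s = t].

(* Skorokhod's J1 distance. It is finite because cadlag functions on [0, 1] are
   bounded; taking the infimum in \bar R avoids relying on this here. *)
Definition skorokhod_dist (x y : D01) : \bar R :=
  ereal_inf [set e%:E | e in [set e : R | exists lam, [/\ time_change lam,
    forall t, `|val (lam t) - val t| <= e &
    forall t, `|x t - y (lam t)| <= e]]].

Lemma nbhs_unit_itvP (t : unit_itv) (A : set unit_itv) :
  nbhs t A <->
  exists2 e : R, 0 < e & forall s, `|val t - val s| < e -> A s.
Proof.
split=> [/nbhs_ballP[e e0 tA]|[e e0 tA]].
  by exists e => // s ts; apply: tA.
by apply/nbhs_ballP; exists e => // s ts; apply: tA.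
Qed.

Lemma unit_itv_ge0 (t : unit_itv) : 0 <= val t.
Proof. by case: t => /= t /set_mem/=; rewrite in_itv/= => /andP[]. Qed.

Lemma unit_itv_le1 (t : unit_itv) : val t <= 1.
Proof. by case: t => /= t /set_mem/=; rewrite in_itv/= => /andP[]. Qed.

Lemma incr_surj_continuous (lam : unit_itv -> unit_itv) :
  (forall s t, val s < val t -> val (lam s) < val (lam t)) ->
  (forall t, exists s, lam s = t) -> continuous lam.
Proof.
move=> incr surj t A /nbhs_unit_itvP[e e0 tA].
have reach (r : R) : 0 <= r <= 1 -> exists s, val (lam s) = r.
  move=> r01; have r01' : r \in (`[0, 1]%classic : set R).
    by rewrite inE/= in_itv.
  by have [s lsr] := surj (exist _ r r01'); exists s; rewrite lsr.
have incrN s s' : val (lam s) < val (lam s') -> val s < val s'.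
  move=> ll; rewrite ltNge le_eqVlt; apply/negP => /orP[/eqP/val_inj ss'|/incr].
    by move: ll; rewrite ss' ltxx.
  by move=> /(lt_trans ll); rewrite ltxx.
have L : exists2 a : R, 0 < a & forall s, val t - val s < a ->
    val (lam t) - val (lam s) < e.
  have [le0|le0] := ltP (val (lam t) - e / 2) 0.
    exists 1 => // s _.
    by have := unit_itv_ge0 (lam s); lra.
  have [|s ls] := reach (val (lam t) - e / 2).
    by rewrite le0 andTb; have := unit_itv_le1 (lam t); lra.
  have st : val s < val t by apply: incrN; rewrite ls; lra.
  exists (val t - val s); first lra.
  move=> u tu; have /incr : val s < val u by lra.
  by rewrite ls; lra.
have U : exists2 a : R, 0 < a & forall s, val s - val t < a ->
    val (lam s) - val (lam t) < e.
  have [le0|le0] := ltP 1 (val (lam t) + e / 2).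
    exists 1 => // s _.
    by have := unit_itv_le1 (lam s); lra.
  have [|s ls] := reach (val (lam t) + e / 2).
    by rewrite le0 andbT; have := unit_itv_ge0 (lam t); lra.
  have st : val t < val s by apply: incrN; rewrite ls; lra.
  exists (val s - val t); first lra.
  move=> u tu; have /incr : val u < val s by lra.
  by rewrite ls; lra.
have [a a0 La] := L; have [b b0 Ub] := U.
apply/nbhs_unit_itvP; exists (Num.min a b); first by rewrite lt_min a0.
move=> s; rewrite lt_min !ltr_norml => /andP[/andP[_ sa] /andP[sb _]].
apply: tA; rewrite ltr_norml; apply/andP; split.
  by have := Ub s; lra.
by apply: La; lra.
Qed.

Lemma time_change_id : time_change id.
Proof. by split => // t; [exact: cvg_id | exists t]. Qed.

Lemma time_change_comp (lam mu : unit_itv -> unit_itv) :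
  time_change lam -> time_change mu -> time_change (mu \o lam).
Proof.
move=> [li lc ls] [mi mc ms]; split => [s t st|t|t].
- exact/mi/li.
- by apply: continuous_comp; [exact: lc | exact: mc].
- by have [s <-] := ms t; have [r <-] := ls s; exists r.
Qed.

Lemma time_change_inv (lam : unit_itv -> unit_itv) : time_change lam ->
  exists2 mu, time_change mu & forall t, lam (mu t) = t.
Proof.
move=> [li lc ls]; have /choice[mu lamK] := ls; exists mu => //.
have mi s t : val s < val t -> val (mu s) < val (mu t).
  move=> st; rewrite ltNge le_eqVlt; apply/negP => /orP[/eqP/val_inj ts|/li].
    by move: st; rewrite -(lamK s) -(lamK t) ts ltxx.
  by rewrite !lamK => /(lt_trans st); rewrite ltxx.
have ms t : exists s, mu s = t.
  exists (lam t); apply: val_inj.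
  have := lamK (lam t); case: (ltgtP (val (mu (lam t))) (val t)) => // /li + e.
    by rewrite e ltxx.
  by rewrite e ltxx.
by split => //; exact: incr_surj_continuous.
Qed.

Definition skorokhod_ball (x : D01) (e : R) : set D01 :=
  [set y | (skorokhod_dist x y < e%:E)%E].

Lemma skorokhod_ballP (x y : D01) (e : R) : skorokhod_ball x e y <->
  exists2 r, r < e & exists lam, [/\ time_change lam,
    forall t, `|val (lam t) - val t| <= r &
    forall t, `|x t - y (lam t)| <= r].
Proof.
split=> [/ereal_inf_lt[_ [r hr <-]]|[r re hr]].
  by rewrite lte_fin => re; exists r.
rewrite /skorokhod_ball/=; apply: (@le_lt_trans _ _ r%:E); last by rewrite lte_fin.
by apply: ereal_inf_lbound; exists r.
Qed.

Lemma skorokhod_ball_center (x : D01) (e : R) : 0 < e -> skorokhod_ball x e x.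
Proof.
move=> e0; apply/skorokhod_ballP; exists 0 => //; exists id.
by split; [exact: time_change_id | move=> t | move=> t]; rewrite subrr normr0.
Qed.

Lemma skorokhod_ball_sym (x y : D01) (e : R) :
  skorokhod_ball x e y -> skorokhod_ball y e x.
Proof.
move=> /skorokhod_ballP[r re [lam [tl l1 l2]]]; apply/skorokhod_ballP.
have [mu tmu lamK] := time_change_inv tl.
exists r => //; exists mu; split => // t; rewrite distrC.
  by have := l1 (mu t); rewrite lamK.
by have := l2 (mu t); rewrite lamK.
Qed.

Lemma skorokhod_ball_triangle (x y z : D01) (e1 e2 : R) :
  skorokhod_ball x e1 y -> skorokhod_ball y e2 z -> skorokhod_ball x (e1 + e2) z.
Proof.
move=> /skorokhod_ballP[r re [lam [tl l1 l2]]].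
move=> /skorokhod_ballP[q qe [mu [tm m1 m2]]]; apply/skorokhod_ballP.
exists (r + q); first by rewrite ltrD.
exists (mu \o lam); split; first exact: time_change_comp.
- move=> t; rewrite [r + q]addrC.
  apply: le_trans (ler_distD (val (lam t)) _ _) _.
  by apply: lerD; [exact: m1 | exact: l1].
- move=> t; apply: le_trans (ler_distD (y (lam t)) _ _) _.
  by apply: lerD; [exact: l2 | exact: m2].
Qed.

HB.instance Definition _ := gen_eqMixin D01.
HB.instance Definition _ := gen_choiceMixin D01.
HB.instance Definition _ := hasNbhs.Build D01 (nbhs_ (entourage_ skorokhod_ball)).
HB.instance Definition _ := @Nbhs_isPseudoMetric.Build R D01
  (entourage_ skorokhod_ball) erefl skorokhod_ball skorokhod_ball_center
  skorokhod_ball_sym skorokhod_ball_triangle erefl.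

Lemma cadlag_cst (c : R) : cadlag (fun=> c).
Proof. by move=> t; split; [|exists c]; exact: cvg_cst. Qed.

HB.instance Definition _ := isPointed.Build D01 (MkD01 (cadlag_cst 0)).

Lemma cadlag_step (a : nat -> R) (n : nat) :
  cadlag (fun t : unit_itv => a (Num.truncn (n%:R * val t))).
Proof.
move=> t; have nt0 : 0 <= n%:R * val t by rewrite mulr_ge0// unit_itv_ge0.
case: n nt0 => [_|n nt0].
  split; [|exists (a 0%N)]; (under eq_fun do rewrite mul0r truncn0).
    by rewrite mul0r truncn0; exact: cvg_cst.
  exact: cvg_cst.
have n0 : 0 < n.+1%:R :> R by rewrite ltr0n.
have cvgE (D : set unit_itv) (k : nat) (e : R) : 0 < e ->
    (forall s, D s -> `|val t - val s| < e -> Num.truncn (n.+1%:R * val s) = k) ->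
    a (Num.truncn (n.+1%:R * val s)) @[s --> within D (nbhs t)] --> a k.
  move=> e0 He.
  apply: cvg_near_cst; rewrite near_withinE; apply/nbhs_unit_itvP.
  by exists e => // s ts Ds /=; rewrite (He s).
set k := Num.truncn (n.+1%:R * val t).
have /andP[kt tk] : k%:R <= n.+1%:R * val t < k.+1%:R by exact: truncn_itv.
split.
- apply: (cvgE _ _ ((k.+1%:R - n.+1%:R * val t) / n.+1%:R)).
    by rewrite divr_gt0// subr_gt0.
  move=> s /= ts; rewrite ltr_pdivlMr// distrC ger0_norm ?subr_ge0// => sk.
  apply: truncn_def; apply/andP; split.
    by rewrite (le_trans kt)// ler_pM2l.
  by move: sk; rewrite mulrBl [val s * _]mulrC [val t * _]mulrC ltrD2r.
- move: kt; rewrite le_eqVlt => /orP[/eqP kt|kt].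
    exists (a k.-1).
    apply: (cvgE _ _ (n.+1%:R)^-1); first by rewrite invr_gt0.
    move=> s /= st; rewrite gtr0_norm ?subr_gt0// -div1r ltr_pdivlMr// => sk.
    case: k kt tk sk => [|k] kt tk sk /=.
      have t0 : val t = 0.
        by apply/eqP; move/esym/eqP: kt; rewrite mulf_eq0 gt_eqF//= => /eqP->.
      by move: st; rewrite t0 ltNge unit_itv_ge0.
    apply: truncn_def; apply/andP; split; last by rewrite kt ltr_pM2l.
    move: sk; rewrite mulrBl [val s * _]mulrC [val t * _]mulrC -kt -[k.+1%:R]natr1.
    by rewrite ltrBlDr [_ + 1]addrC ltrD2l => /ltW.
  exists (a k).
  apply: (cvgE _ _ ((n.+1%:R * val t - k%:R) / n.+1%:R)).
    by rewrite divr_gt0// subr_gt0.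
  move=> s /= st; rewrite ltr_pdivlMr// gtr0_norm ?subr_gt0// => sk.
  apply: truncn_def; apply/andP; split.
    move: sk; rewrite mulrBl [val s * _]mulrC [val t * _]mulrC.
    by rewrite ltrD2l ltrN2 => /ltW.
  by rewrite (lt_trans _ tk)// ltr_pM2l.
Qed.

End skorokhod.

Section walk.
Context {R : realType}.

(* The sequences are indexed from 0: xi n and eta n are the increments used in
   the step from time n to time n + 1. *)
Fixpoint walk (xi eta : nat -> R) (n : nat) : R :=
  if n is m.+1 then
    walk xi eta m + (if 0 < walk xi eta m then xi m else eta m)
  else 0.

Definition walk_at (xi eta : nat -> R) (t : R) : R :=
  walk xi eta (Num.truncn t).

Definition rescaled_walk (xi eta : nat -> R) (n : nat) : D01 R :=
  @MkD01 R (fun t => walk_at xi eta (n%:R * val t) / Num.sqrt n%:R)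
    (cadlag_step (fun k => walk xi eta k / Num.sqrt n%:R) n).

(* The set is finite and nonempty, so its supremum is a maximum. *)
Definition rescaled_max (xi eta : nat -> R) (n : nat) (t : R) : R :=
  sup [set walk_at xi eta (n%:R * s) / Num.sqrt n%:R | s in `[0, t]].

End walk.

(* Main.v *)
Require Import Defs.
From HB Require Import structures.
From mathcomp Require Import all_boot all_order all_algebra finmap.
From mathcomp Require Import all_classical all_reals all_analysis.
From mathcomp Require Import measurable_realfun ring lra.

(** The Lyapunov function behind the proof. Put a = delta sqrt n and
    B = c sqrt n, and run the walk until it leaves [-a, B[. On that interval
    consider

      W x = G + (2 / sigma^2) (x + a) (2 B - x),

    extended by 0 outside. A step from x > 0 decreases W by 2 on average, up to
    an overshoot controlled by E[xi^2; |xi| > a] = o(1). A step from x <= 0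
    leaves the interval with probability at least p = P(eta > a + B), and
    otherwise increases W by O(sqrt n) E[eta; eta <= a + B] on average, so that
    G = (1 + O(sqrt n) E[eta; eta <= a + B]) / p makes W decrease by 1 there
    too. Hence n P(the walk is confined up to time n) <= W 0. When the tail of
    eta is slowly varying, E[eta; eta <= y] = o(y P(eta > y)) and
    y P(eta > y) tends to infinity, so W 0 = o(n) + O(delta c n), and delta is
    arbitrary. Finally, the walk is never below - max |xi_k|, which exceeds a
    with vanishing probability; so the walk can only leave through B.

    For the first claim, a weak limit would be carried by paths of infinite
    supremum, whereas cadlag paths are bounded. *)

Set Implicit Arguments.
Unset Strict Implicit.
Unset Printing Implicit Defensive.

Import Order.TTheory GRing.Theory Num.Theory.
Import numFieldNormedType.Exports.

Local Open Scope classical_set_scope.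
Local Open Scope ring_scope.

(** * Independence of the next increments from the past *)

(** Agreement on rectangles makes the joint law the product of the marginals, and Tonelli applies.
    With [X] the present state and [Y] the next increment, this replaces conditioning on the
    past. *)
Lemma ge0_integral_indep (R : realType) (d : measure_display) (T : measurableType d)
  (P : probability T R) (X Y : {RV P >-> R}) (h : R * R -> \bar R) :
  (forall A B, measurable A -> measurable B ->
    P (X @^-1` A `&` Y @^-1` B) = (P (X @^-1` A) * P (Y @^-1` B))%E) ->
  measurable_fun setT h -> (forall z, 0 <= h z)%E ->
  (\int[P]_w h (X w, Y w) = \int[P]_w \int[distribution P Y]_y h (X w, y))%E.
Proof.
move=> XY mh h0.
have mXY : measurable_fun setT (fun w => (X w, Y w)).
  exact: measurable_fun_pair.
pose m : probability _ R := distribution P (mfun_Sub (mem_set mXY)).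
have mE A : measurable A -> (distribution P X \x distribution P Y)%E A = m A.
  move=> mA; apply: product_measure_unique mA => /= B C mB mC.
  by rewrite -XY.
transitivity (\int[m]_z h z)%E.
  by rewrite ge0_integral_distribution.
transitivity (\int[(distribution P X \x distribution P Y)%E]_z h z)%E.
  by apply: eq_measure_integral => A mA _; exact/esym/mE.
rewrite fubini_tonelli1// /fubini_F ge0_integral_distribution//=.
- exact: (measurable_fun_fubini_tonelli_F (m2 := distribution P Y)).
- by move=> y; apply: (integral_ge0 (distribution P Y)) => z _; exact: h0.
Qed.

(** Only cylinder events, not the sigma-algebra they generate: they form a pi-system on which
    independence can be checked directly. *)
Definition history {R : realType} {T : Type} (X Y : nat -> T -> R) (k : nat) :
    set (set T) :=
  [set E | exists B C : nat -> set R, [/\ forall i, measurable (B i),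
    forall i, measurable (C i) &
    E = (\bigcap_(i in `I_k) X i @^-1` B i) `&`
        (\bigcap_(i in `I_k) Y i @^-1` C i)]].

Lemma history_setI_closed (R : realType) (T : Type) (X Y : nat -> T -> R) (k : nat) :
  setI_closed (history X Y k).
Proof.
move=> _ _ [B [C [mB mC ->]]] [B' [C' [mB' mC' ->]]].
exists (fun i => B i `&` B' i), (fun i => C i `&` C' i); split.
- by move=> i; exact: measurableI.
- by move=> i; exact: measurableI.
- by rewrite setIACA -!bigcapI.
Qed.

Lemma history_setT (R : realType) (T : Type) (X Y : nat -> T -> R) (k : nat) :
  history X Y k setT.
Proof.
exists (fun=> setT), (fun=> setT); split => //.
by apply/esym/seteqP; split.
Qed.

Lemma sub_history (R : realType) (T : Type) (X Y : nat -> T -> R) (k m : nat) :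
  (k <= m)%N -> history X Y k `<=` history X Y m.
Proof.
move=> km _ [B [C [mB mC ->]]].
exists (fun i => if (i < k)%N then B i else setT),
  (fun i => if (i < k)%N then C i else setT); split.
- by move=> i; case: ifP.
- by move=> i; case: ifP.
- apply/seteqP; split => w /= -[Bw Cw]; split => i /= im.
  + by case: ifP => // /Bw.
  + by case: ifP => // /Cw.
  + by have := Bw i (leq_trans im km); rewrite im.
  + by have := Cw i (leq_trans im km); rewrite im.
Qed.

Lemma history_preimagel (R : realType) (T : Type) (X Y : nat -> T -> R) (k : nat)
    (B : set R) : measurable B -> history X Y k.+1 (X k @^-1` B).
Proof.
move=> mB; exists (fun i => if i == k then B else setT), (fun=> setT); split => //.
  by move=> i; case: ifP.
apply/seteqP; split => w /= => [Bw|[Bw _]].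
  by split => // i _; case: eqP => // ->.
by have := Bw k (ltnSn k); rewrite eqxx.
Qed.

Lemma history_preimager (R : realType) (T : Type) (X Y : nat -> T -> R) (k : nat)
    (B : set R) : measurable B -> history X Y k.+1 (Y k @^-1` B).
Proof.
move=> mB; exists (fun=> setT), (fun i => if i == k then B else setT); split => //.
  by move=> i; case: ifP.
apply/seteqP; split => w /= => [Bw|[_ Bw]].
  by split => // i _; case: eqP => // ->.
by have := Bw k (ltnSn k); rewrite eqxx.
Qed.

Lemma history_measurable (R : realType) (d : measure_display) (T : measurableType d)
    (P : probability T R) (X Y : nat -> {RV P >-> R}) (k : nat) :
  history X Y k `<=` measurable.
Proof.
move=> _ [B [C [mB mC ->]]].
by apply: measurableI; apply: bigcap_measurableType => i _; exact: measurable_funPTI.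
Qed.

Lemma mutually_independent_prefix (R : realType) (d : measure_display)
    (T : measurableType d) (P : probability T R) (X : nat -> {RV P >-> R})
    (B : nat -> set R) (k : nat) :
  mutually_independent X -> (forall i, measurable (B i)) ->
  P (\bigcap_(i in `I_k) X i @^-1` B i) = (\prod_(i < k) P (X i @^-1` B i))%E.
Proof.
move=> + mB => /(_ [fset i in iota 0 k]%fset B mB) XB.
have -> : `I_k = [set` [fset i in iota 0 k]%fset].
  by apply/seteqP; split => i /=; rewrite !inE mem_iota add0n.
rewrite XB -(big_mkord xpredT (fun i => P (X i @^-1` B i))) /index_iota subn0.
apply: perm_big; apply: uniq_perm; rewrite ?fset_uniq ?iota_uniq// => i.
by rewrite !inE.
Qed.

Lemma historyC (R : realType) (T : Type) (X Y : nat -> T -> R) (k : nat) :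
  history X Y k = history Y X k.
Proof.
apply/seteqP; split => _ [B [C [mB mC ->]]]; exists C, B; split => //;
  exact: setIC.
Qed.

Lemma independent_sequencesC (R : realType) (d : measure_display)
    (T : measurableType d) (P : probability T R) (X Y : nat -> {RV P >-> R}) :
  independent_sequences X Y -> independent_sequences Y X.
Proof. by move=> XY A B YA XB; rewrite setIC XY// muleC. Qed.

Lemma generated_sigma_algebra_prefix (R : realType) (d : measure_display)
    (T : measurableType d) (P : probability T R) (X : nat -> {RV P >-> R})
    (B : nat -> set R) (k : nat) :
  (forall i, measurable (B i)) ->
  generated_sigma_algebra X (\bigcap_(i in `I_k) X i @^-1` B i).
Proof.
move=> mB; rewrite /generated_sigma_algebra; set G := \bigcup_i _.
apply: (@bigcap_measurableType _ (g_sigma_algebraType G)) => i _.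
apply: sub_sigma_algebra; by exists i => //; exists (B i) => //; rewrite setTI.
Qed.

(** Both sides are finite measures in [E]. On cylinders they agree by a product formula, and
    uniqueness of measures on a pi-system extends this to the generated sigma-algebra. *)
Lemma history_indepl (R : realType) (d : measure_display)
    (T : measurableType d) (P : probability T R) (X Y : nat -> {RV P >-> R})
    (k : nat) (E : set T) (B : set R) :
  mutually_independent X -> independent_sequences X Y ->
  <<s history X Y k >> E -> measurable B ->
  P (E `&` X k @^-1` B) = (P E * P (X k @^-1` B))%E.
Proof.
move=> Xind XY hE mB; set F := X k @^-1` B.
have mF : measurable F by exact: measurable_funPTI.
have PFge0 : 0 <= fine (P F) by exact: fine_ge0.
have -> : P (E `&` F) = mrestr P mF E by [].
have -> : (P E * P F)%E = mscale (NngNum PFge0) P E.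
  by rewrite /mscale/= fineK ?fin_num_measure// muleC.
apply: (@g_sigma_algebra_measure_unique _ _ _ (history X Y k) _ (fun=> setT)) hE.
- exact: history_measurable.
- by move=> _; exact: history_setT.
- by rewrite bigcup_const.
- exact: history_setI_closed.
- move=> _ [C [D [mC mD ->]]].
  rewrite /= /mrestr /mscale/= fineK ?fin_num_measure//.
  (* The event on [X k] becomes the [k]-th factor of the cylinder, after which the [X] block and the
     [Y] block separate. *)
  pose C' i := if i == k then B else C i.
  have mC' i : measurable (C' i) by rewrite /C'; case: ifP.
  have -> : (\bigcap_(i in `I_k) X i @^-1` C i) `&`
      (\bigcap_(i in `I_k) Y i @^-1` D i) `&` F =
      (\bigcap_(i in `I_k.+1) X i @^-1` C' i) `&`
      (\bigcap_(i in `I_k) Y i @^-1` D i).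
    rewrite setIAC; congr (_ `&` _).
    apply/seteqP; split => w /=.
      move=> [Cw Bw] i; rewrite /= ltnS leq_eqVlt /C' => /predU1P[->|ik].
        by rewrite eqxx.
      by rewrite ltn_eqF//; exact: Cw.
    move=> Cw; split=> [i /= ik|]; last by have := Cw k (ltnSn k); rewrite /C' eqxx.
    by have := Cw i (ltnW ik); rewrite /C' ltn_eqF.
  rewrite !XY; try exact: generated_sigma_algebra_prefix.
  rewrite !(mutually_independent_prefix _ Xind)// big_ord_recr/= {2}/C' eqxx -/F.
  rewrite muleAC [RHS]muleC; congr (_ * _ * _)%E.
  by apply: eq_bigr => i _; rewrite /C' ltn_eqF.
- by move=> _; rewrite /= /mrestr setTI -ge0_fin_numE ?fin_num_measure.
Qed.

Lemma history_indepr (R : realType) (d : measure_display)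
    (T : measurableType d) (P : probability T R) (X Y : nat -> {RV P >-> R})
    (k : nat) (E : set T) (B : set R) :
  mutually_independent Y -> independent_sequences X Y ->
  <<s history X Y k >> E -> measurable B ->
  P (E `&` Y k @^-1` B) = (P E * P (Y k @^-1` B))%E.
Proof.
move=> Yind XY; rewrite historyC; apply: history_indepl => //.
exact: independent_sequencesC.
Qed.

(** * The killed walk and its survival probability *)

(* The walk, frozen once it has left I; freezing makes survival up to time n a
   function of the state at time n alone. *)
Fixpoint killed_walk {R : realType} (I : interval R) (xi eta : nat -> R) (n : nat) : R :=
  if n is m.+1 then
    let x := killed_walk I xi eta m in
    if x \in I then x + (if 0 < x then xi m else eta m) else x
  else 0.

Lemma measurable_mem_itv (R : realType) (d : measure_display)
    (T : measurableType d) (f : T -> R) (I : interval R) :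
  measurable_fun setT f -> measurable_fun setT (fun t => f t \in I).
Proof.
move=> mf; apply: (measurable_fun_bool true) => //.
have -> : (fun t => f t \in I) @^-1` [set true] = f @^-1` [set` I] by [].
by apply: mf => //; exact: measurable_itv.
Qed.

(** Adaptedness: the position at time [k] uses only increments of index below [k], which is what
    makes it independent of [X k] and of [Y k]. *)
Lemma killed_walk_history (R : realType) (d : measure_display)
    (T : measurableType d) (P : probability T R) (X Y : nat -> {RV P >-> R})
    (I : interval R) (k : nat) (C : set R) : measurable C ->
  <<s history X Y k >> ((fun w => killed_walk I (X ^~ w) (Y ^~ w) k) @^-1` C).
Proof.
suff: measurable_fun setT
    ((fun w => killed_walk I (X ^~ w) (Y ^~ w) k) : g_sigma_algebraType (history X Y k) -> R).
  by move=> mk mC; rewrite -[X in _ X]setTI; exact: mk.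
elim: k => [|k IH]; first exact: measurable_cst.
have mS : measurable_fun setT
    ((fun w => killed_walk I (X ^~ w) (Y ^~ w) k) : g_sigma_algebraType (history X Y k.+1) -> R).
  move=> _ D mD; have := IH measurableT D mD.
  by apply: sub_sigma_algebra2; apply: sub_history; exact: leqnSn.
have mX : measurable_fun setT (X k : g_sigma_algebraType (history X Y k.+1) -> R).
  move=> _ D mD; rewrite setTI; apply: sub_sigma_algebra.
  exact: history_preimagel.
have mY : measurable_fun setT (Y k : g_sigma_algebraType (history X Y k.+1) -> R).
  move=> _ D mD; rewrite setTI; apply: sub_sigma_algebra.
  exact: history_preimager.
apply: measurable_fun_ifT => //; first exact: measurable_mem_itv.
apply: measurable_funD => //; apply: measurable_fun_ifT => //.
exact: measurable_fun_ltr.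
Qed.

Lemma measurable_killed_walk (R : realType) (d : measure_display)
    (T : measurableType d) (P : probability T R) (X Y : nat -> {RV P >-> R})
    (I : interval R) (k : nat) :
  measurable_fun setT (fun w => killed_walk I (X ^~ w) (Y ^~ w) k).
Proof.
move=> _ C mC; rewrite setTI.
have : <<s history X Y k >> `<=` measurable.
  apply: smallest_sub; [exact: sigma_algebra_measurable|].
  exact: history_measurable.
by apply; exact: killed_walk_history.
Qed.

(** By independence the next value of [W] may be integrated over the increment with the current
    position held fixed; the two drift hypotheses then apply pointwise. *)
Lemma killed_walk_drift (R : realType) (d : measure_display)
    (T : measurableType d) (P : probability T R) (X Y : nat -> {RV P >-> R})
    (I : interval R) (W : R -> R) (k : nat) :
  iid X -> iid Y -> independent_sequences X Y ->
  measurable_fun setT W -> (forall x, 0 <= W x) ->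
  (forall x, x \notin I -> W x = 0) ->
  (forall x, x \in I -> 0 < x ->
    (\int[P]_w (W (x + X 0%N w))%:E + 1 <= (W x)%:E)%E) ->
  (forall x, x \in I -> x <= 0 ->
    (\int[P]_w (W (x + Y 0%N w))%:E + 1 <= (W x)%:E)%E) ->
  (\int[P]_w (W (killed_walk I (X ^~ w) (Y ^~ w) k.+1))%:E +
   P [set w | killed_walk I (X ^~ w) (Y ^~ w) k \in I] <=
   \int[P]_w (W (killed_walk I (X ^~ w) (Y ^~ w) k))%:E)%E.
Proof.
move=> [Xind Xid] [Yind Yid] XY mW W0 WI HX HY.
pose S : {RV P >-> R} := mfun_Sub (mem_set (measurable_killed_walk X Y I k)).
(* One integrand for each branch of the walk. Both vanish off [I], in agreement with a frozen walk
   and a [W] that is 0 there. *)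
pose hX (z : R * R) := (if (z.1 \in I) && (0 < z.1) then W (z.1 + z.2) else 0)%:E.
pose hY (z : R * R) := (if (z.1 \in I) && ~~ (0 < z.1) then W (z.1 + z.2) else 0)%:E.
have mWD : measurable_fun setT (fun z : R * R => W (z.1 + z.2)).
  by apply: measurableT_comp => //; apply: measurable_funD.
have mI : measurable_fun setT (fun z : R * R => z.1 \in I).
  exact: measurable_mem_itv.
have mpos : measurable_fun setT (fun z : R * R => 0 < z.1).
  exact: measurable_fun_ltr.
have mhX : measurable_fun setT hX.
  apply/measurable_EFinP; apply: measurable_fun_ifT => //.
  exact: measurable_and.
have mhY : measurable_fun setT hY.
  apply/measurable_EFinP; apply: measurable_fun_ifT => //.
  by apply: measurable_and => //; exact: measurable_neg.
have hX0 z : (0 <= hX z)%E by rewrite lee_fin; case: ifP.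
have hY0 z : (0 <= hY z)%E by rewrite lee_fin; case: ifP.
have -> : (\int[P]_w (W (killed_walk I (X ^~ w) (Y ^~ w) k.+1))%:E =
    \int[P]_w hX (S w, X k w) + \int[P]_w hY (S w, Y k w))%E.
  rewrite -ge0_integralD//; last 2 first.
  - exact: (measurableT_comp mhX (measurable_fun_pair _ _)).
  - exact: (measurableT_comp mhY (measurable_fun_pair _ _)).
  apply: eq_integral => w _; rewrite /hX /hY /= -EFinD; congr EFin.
  case: ifPn => [_|/WI->]; last by rewrite addr0.
  by case: ifPn; rewrite ?addr0 ?add0r.
pose gX x := (\int[distribution P (X 0%N)]_y hX (x, y))%E.
pose gY x := (\int[distribution P (Y 0%N)]_y hY (x, y))%E.
have mgX : measurable_fun setT gX.
  exact: (measurable_fun_fubini_tonelli_F (m2 := distribution P (X 0%N))).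
have mgY : measurable_fun setT gY.
  exact: (measurable_fun_fubini_tonelli_F (m2 := distribution P (Y 0%N))).
have -> : (\int[P]_w hX (S w, X k w) = \int[P]_w gX (S w))%E.
  rewrite ge0_integral_indep//; last first.
    move=> A B mA mB; apply: (history_indepl Xind XY) => //.
    exact: killed_walk_history.
  apply: eq_integral => w _; apply: eq_measure_integral => A _ _.
  by rewrite /= Xid.
have -> : (\int[P]_w hY (S w, Y k w) = \int[P]_w gY (S w))%E.
  rewrite ge0_integral_indep//; last first.
    move=> A B mA mB; apply: (history_indepr Yind XY) => //.
    exact: killed_walk_history.
  apply: eq_integral => w _; apply: eq_measure_integral => A _ _.
  by rewrite /= Yid.
have gX0 x : (0 <= gX x)%E by apply: (integral_ge0 (distribution P (X 0%N))).
have gY0 x : (0 <= gY x)%E by apply: (integral_ge0 (distribution P (Y 0%N))).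
have mSI : measurable [set w | S w \in I].
  have -> : [set w | S w \in I] = S @^-1` [set` I] by [].
  exact: measurable_funPTI.
have mgXS : measurable_fun setT (gX \o S) by exact: measurableT_comp.
have mgYS : measurable_fun setT (gY \o S) by exact: measurableT_comp.
have mWS : measurable_fun setT (fun w => (W (S w))%:E).
  by apply/measurable_EFinP; exact: measurableT_comp.
have -> : P [set w | S w \in I] = (\int[P]_w (\1_[set w | S w \in I] w)%:E)%E.
  by rewrite integral_indic// setIT.
rewrite -ge0_integralD// -ge0_integralD//; last 3 first.
- by move=> w _; apply: adde_ge0.
- exact: emeasurable_funD.
- by apply/measurable_EFinP.
apply: ge0_le_integral => //.
- by move=> w _; apply: adde_ge0 => //; apply: adde_ge0.
- by apply: emeasurable_funD; [exact: emeasurable_funD | exact/measurable_EFinP].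
move=> w _; rewrite indicE; have [SI|SI] := boolP (S w \in I).
  have [S0|S0] := boolP (0 < S w).
    have -> : gY (S w) = 0%E.
      rewrite /gY; under eq_integral do rewrite /hY /= SI S0.
      exact: (integral0 (distribution P (Y 0%N))).
    have -> : gX (S w) = (\int[P]_w' (W (S w + X 0%N w'))%:E)%E.
      rewrite /gX; under eq_integral do rewrite /hX /= SI S0.
      rewrite (ge0_integral_distribution (X 0%N) (f := fun y => (W (S w + y))%:E))//.
        apply/measurable_EFinP; apply: measurableT_comp => //.
        exact: measurable_funD.
      by move=> y; rewrite lee_fin.
    by rewrite adde0 mem_set//; exact: HX.
  have -> : gX (S w) = 0%E.
    rewrite /gX; under eq_integral do rewrite /hX /= SI (negbTE S0).
    exact: (integral0 (distribution P (X 0%N))).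
  have -> : gY (S w) = (\int[P]_w' (W (S w + Y 0%N w'))%:E)%E.
    rewrite /gY; under eq_integral do rewrite /hY /= SI S0.
    rewrite (ge0_integral_distribution (Y 0%N) (f := fun y => (W (S w + y))%:E))//.
      apply/measurable_EFinP; apply: measurableT_comp => //.
      exact: measurable_funD.
    by move=> y; rewrite lee_fin.
  by rewrite add0e mem_set//; apply: HY => //; rewrite leNgt.
have -> : gX (S w) = 0%E.
  rewrite /gX; under eq_integral do rewrite /hX /= (negbTE SI).
  exact: (integral0 (distribution P (X 0%N))).
have -> : gY (S w) = 0%E.
  rewrite /gY; under eq_integral do rewrite /hY /= (negbTE SI).
  exact: (integral0 (distribution P (Y 0%N))).
by rewrite memNset ?adde0 ?lee_fin//; exact/negP.
Qed.

(** Freezing makes the survival events decrease, so each of the [n] steps costs [W] at least the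
    probability of surviving up to time [n], while [W] starts from [W 0] and stays nonnegative. *)
Lemma killed_walk_survival (R : realType) (d : measure_display)
    (T : measurableType d) (P : probability T R) (X Y : nat -> {RV P >-> R})
    (I : interval R) (W : R -> R) (n : nat) :
  iid X -> iid Y -> independent_sequences X Y ->
  measurable_fun setT W -> (forall x, 0 <= W x) ->
  (forall x, x \notin I -> W x = 0) ->
  (forall x, x \in I -> 0 < x ->
    (\int[P]_w (W (x + X 0%N w))%:E + 1 <= (W x)%:E)%E) ->
  (forall x, x \in I -> x <= 0 ->
    (\int[P]_w (W (x + Y 0%N w))%:E + 1 <= (W x)%:E)%E) ->
  (n%:R%:E * P [set w | killed_walk I (X ^~ w) (Y ^~ w) n \in I] <=
    (W 0)%:E)%E.
Proof.
move=> iX iY XY mW W0 WI HX HY.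
pose A k := [set w | killed_walk I (X ^~ w) (Y ^~ w) k \in I].
have mA k : measurable (A k).
  have -> : A k = (fun w => killed_walk I (X ^~ w) (Y ^~ w) k) @^-1` [set` I] by [].
  by rewrite -[_ @^-1` _]setTI; apply: measurable_killed_walk.
suff: (\int[P]_w (W (killed_walk I (X ^~ w) (Y ^~ w) n))%:E +
    n%:R%:E * P (A n) <= (W 0)%:E)%E.
  by apply: le_trans; apply: leeDr; apply: integral_ge0 => w _; rewrite lee_fin.
elim: n => [|n IH].
  rewrite mul0e adde0 /=.
  by have := expectation_cst P (W 0); rewrite unlock => ->.
apply: le_trans IH; apply: (@le_trans _ _
  (\int[P]_w (W (killed_walk I (X ^~ w) (Y ^~ w) n.+1))%:E + P (A n) +
    n%:R%:E * P (A n))%E); last first.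
  by apply: leeD => //; exact: killed_walk_drift.
have AS : (P (A n.+1) <= P (A n))%E.
  apply: le_measure; rewrite ?inE//.
  by rewrite /A => w /=; case: ifPn => // /negbTE->.
rewrite -addeA leeD2l// -natr1 EFinD ge0_muleDl// mul1e addeC.
by apply: leeD => //; apply: lee_wpmul2l.
Qed.

(** * The Lyapunov function and its drift on both sides of 0 *)

Lemma measurable_norm_gt (R : realType) (d : measure_display)
    (T : measurableType d) (P : probability T R) (X : {RV P >-> R}) (a : R) :
  measurable [set w | a < `|X w|].
Proof.
rewrite (_ : [set w | a < `|X w|] = (fun w => `|X w|) @^-1` `]a, +oo[%classic).
  rewrite -[_ @^-1` _]setTI.
  exact: (measurableT_comp (@normr_measurable R setT) _).
by apply/seteqP; split => w /=; rewrite in_itv/= andbT.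
Qed.

(** In use [I] is [-a, B[ and [b] is 2 B. The second root lies beyond the exit level, so that a jump
    of size at most a <= B from a point of ]0, B[ cannot reach a place where the parabola is
    negative. *)
Definition lyapunov {R : realType} (G k a b : R) (I : interval R) (x : R) : R :=
  if x \in I then G + k * ((x + a) * (b - x)) else 0.

Lemma measurable_lyapunov (R : realType) (G k a b : R) (I : interval R) :
  measurable_fun setT (lyapunov G k a b I).
Proof.
apply: measurable_fun_ifT => //; first exact: measurable_mem_itv.
apply: measurable_funD => //; apply: measurable_funM => //.
by apply: measurable_funM; [exact: measurable_funD|exact: measurable_funB].
Qed.

Lemma integrable_sqr_ltey (R : realType) (d : measure_display)
    (T : measurableType d) (P : probability T R) (X : {RV P >-> R}) :
  (\int[P]_w (X w ^+ 2)%:E < +oo)%E ->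
  P.-integrable setT (fun w => (X w ^+ 2)%:E).
Proof.
move=> X2; apply/integrableP; split.
  by apply/measurable_EFinP; exact: measurable_funX.
rewrite (_ : integral _ _ _ = \int[P]_w (X w ^+ 2)%:E)%E//.
by apply: eq_integral => w _; rewrite gee0_abs// lee_fin sqr_ge0.
Qed.

Lemma integrable_of_sqr (R : realType) (d : measure_display)
    (T : measurableType d) (P : probability T R) (X : {RV P >-> R}) :
  (\int[P]_w (X w ^+ 2)%:E < +oo)%E ->
  P.-integrable setT (fun w => (X w)%:E).
Proof.
move=> X2; apply: (@le_integrable _ _ _ P setT _ _ (fun w => (1 + X w ^+ 2)%:E)) => //.
- exact/measurable_EFinP.
- move=> w _; rewrite lee_fin [leRHS]ger0_norm; last by rewrite addr_ge0// sqr_ge0.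
  rewrite -real_normK ?num_real//; have := sqr_ge0 (`|X w| - 1); nra.
- under eq_fun do rewrite EFinD.
  apply: integrableD => //; last exact: integrable_sqr_ltey.
  exact: finite_measure_integrable_cst.
Qed.

Lemma lyapunov_ge0 (R : realType) (G k a B x : R) :
  0 <= G -> 0 <= k -> 0 <= B -> 0 <= lyapunov G k a (2 * B) `[-a, B[ x.
Proof.
move=> G0 k0 B0; rewrite /lyapunov in_itv/=; case: ifP => // /andP[ax xB].
by rewrite addr_ge0// !mulr_ge0//; lra.
Qed.

(** The right side is the parabola at x + y, expanded in y, plus an overshoot correction. Where the
    function is cut to 0 the parabola may be negative, but only if |y| > a, and the correction then
    covers it. *)
Lemma lyapunov_le (R : realType) (G k a B x y : R) :
  0 <= G -> 0 <= k -> 0 < a -> a <= B -> 0 < x -> x < B ->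
  lyapunov G k a (2 * B) `[-a, B[ (x + y) <=
    G + k * ((x + a) * (2 * B - x)) + (k * (2 * B - x - (x + a)) * y +
      (- k * y ^+ 2 +
        k * (1 + 2 * B / a) * (if a < `|y| then y ^+ 2 else 0))).
Proof.
move=> G0 k0 a0 aB x0 xB.
have B0 : 0 < B by lra.
set q := (if _ then _ else _).
have -> : G + k * ((x + a) * (2 * B - x)) + (k * (2 * B - x - (x + a)) * y +
    (- k * y ^+ 2 + k * (1 + 2 * B / a) * q)) =
    G + k * ((x + y + a) * (2 * B - (x + y)) + (1 + 2 * B / a) * q) by ring.
have Ba0 : 0 <= 2 * B / a by rewrite divr_ge0//; lra.
have q0 : 0 <= q by rewrite /q; case: ifP => // _; exact: sqr_ge0.
rewrite /lyapunov; case: ifPn => xyI.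
  rewrite lerD2l ler_wpM2l// lerDl mulr_ge0//; lra.
rewrite addr_ge0// mulr_ge0//; rewrite /q; case: ltP => ya.
  (* Here |y| <= y^2 / a, and the coefficient of the linear term is at most 2 B in absolute
     value. *)
  have Bya : 2 * B * `|y| <= 2 * B / a * y ^+ 2.
    rewrite -real_normK ?num_real// expr2 mulrA ler_wpM2r//.
    rewrite mulrAC ler_pdivlMr// ler_wpM2l//; lra.
  have yB : - (2 * B * `|y|) <= (2 * B - 2 * x - a) * y.
    rewrite lerNl -mulNr; apply: (le_trans (ler_norm _)).
    rewrite normrM ler_wpM2r// ler_norml; apply/andP; split; lra.
  have : 0 <= (x + a) * (2 * B - x) by rewrite mulr_ge0//; lra.
  lra.
(* For |y| <= a the point x + y stays in [-a, 2 B], where the parabola is nonnegative. *)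
rewrite mulr0 addr0; move: ya; rewrite ler_norml => /andP[ya1 ya2].
rewrite mulr_ge0//; lra.
Qed.

(** When [lyapunov_le] is integrated, the linear term vanishes by centring, the quadratic one gives
    [- k * sigma ^+ 2 = -2], and the overshoot correction costs at most 1. *)
Lemma lyapunov_drift_above (R : realType) (d : measure_display)
    (T : measurableType d) (P : probability T R) (X : {RV P >-> R})
    (sigma G a B : R) :
  'E_P[X]%E = 0%E -> 'E_P[fun w => (X w ^+ 2)%R]%E = (sigma ^+ 2)%:E ->
  0 < sigma -> 0 <= G -> 0 < a -> a <= B ->
  ((1 + 2 * B / a)%:E * \int[P]_(w in [set w | (a < `|X w|)%R]) (X w ^+ 2)%:E <=
    (sigma ^+ 2 / 2)%:E)%E ->
  let W := lyapunov G (2 / sigma ^+ 2) a (2 * B) (`[-a, B[) in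
  forall x, x \in `[-a, B[ -> 0 < x ->
    (\int[P]_w (W (x + X w))%:E + 1 <= (W x)%:E)%E.
Proof.
rewrite unlock => X1 X2 sigma0 G0 a0 aB tailX W x xI x0.
set k := 2 / sigma ^+ 2 in W *.
have s20 : 0 < sigma ^+ 2 by rewrite exprn_gt0.
have k0 : 0 < k by rewrite divr_gt0.
pose A := [set w | a < `|X w|].
have mA : measurable A by exact: measurable_norm_gt.
have iX2 : P.-integrable setT (fun w => (X w ^+ 2)%:E).
  by apply: integrable_sqr_ltey; rewrite X2 ltry.
have iX : P.-integrable setT (fun w => (X w)%:E).
  by apply: integrable_of_sqr; rewrite X2 ltry.
have iX2A : P.-integrable A (fun w => (X w ^+ 2)%:E) by exact: integrableS iX2.
have xB : x < B by move: xI; rewrite in_itv/= => /andP[].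
pose q : T -> \bar R := (fun w => (X w ^+ 2)%:E) \_ A.
have iq : P.-integrable setT q by rewrite /q -integrable_mkcond.
have -> : W x = G + k * ((x + a) * (2 * B - x)) by rewrite /W /lyapunov xI.
pose c0 := G + k * ((x + a) * (2 * B - x)).
pose c1 := k * (2 * B - x - (x + a)).
pose c3 := k * (1 + 2 * B / a).
have c30 : 0 <= c3.
  apply: mulr_ge0; first exact: ltW.
  by apply: addr_ge0 => //; apply: divr_ge0; lra.
have i1 := integrableZl measurableT c1 iX.
have i2 := integrableZl measurableT (- k) iX2.
have i3 := integrableZl measurableT c3 iq.
have i0 : P.-integrable setT (EFin \o cst c0).
  exact: finite_measure_integrable_cst.
have tfin := integrable_fin_num mA iX2A.
rewrite -/A -(fineK tfin) -EFinM lee_fin in tailX.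
set t := fine _ in tailX.
apply: (@le_trans _ _ (\int[P]_w ((EFin \o cst c0) w + (c1%:E * (X w)%:E +
     ((- k)%:E * (X w ^+ 2)%:E + c3%:E * q w))) + 1)%E).
  rewrite leeD2r//; apply: ge0_le_integral => //.
  - by move=> w _; rewrite lee_fin; apply: lyapunov_ge0 => //; lra.
  - apply/measurable_EFinP; apply: measurableT_comp; first exact: measurable_lyapunov.
    exact: measurable_funD.
  - by apply: (@measurable_int _ _ _ P); do !apply: integrableD => //.
  - move=> w _; have -> : q w = (if a < `|X w| then X w ^+ 2 else 0)%:E.
      have -> : (a < `|X w|) = (w \in A) by apply/idP/idP; rewrite inE.
      by rewrite /q patchE; case: ifP.
    by rewrite -!EFinM -!EFinD lee_fin; apply: lyapunov_le => //; exact: ltW.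
rewrite integralD//; last by do !apply: integrableD => //.
rewrite integralD//; last by apply: integrableD.
rewrite integralD// !integralZl// X1 X2 -integral_mkcond mule0 add0e.
have -> : (\int[P]_w (EFin \o cst c0) w = c0%:E)%E.
  by have := expectation_cst P c0; rewrite unlock.
rewrite -(fineK tfin) -/t.
rewrite -!EFinM -!EFinD lee_fin.
have ks : k * sigma ^+ 2 = 2 by rewrite /k divfK// gt_eqF.
have : c3 * t <= 1.
  have -> : 1 = k * (sigma ^+ 2 / 2) by rewrite mulrA ks divff.
  by rewrite /c3 -mulrA ler_wpM2l// ltW.
rewrite mulNr ks /c0; lra.
Qed.

Lemma ccdfE (R : realType) (d : measure_display) (T : measurableType d)
    (P : probability T R) (Y : {RV P >-> R}) (y : R) :
  ccdf Y y = P [set w | y < Y w].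
Proof.
rewrite /ccdf /distribution /pushforward /=; congr (P _).
by apply/seteqP; split => w /=; rewrite in_itv/= andbT.
Qed.

Lemma measurable_RV_itv (R : realType) (d : measure_display)
    (T : measurableType d) (P : probability T R) (Y : {RV P >-> R})
    (I : interval R) : measurable [set w | Y w \in I].
Proof.
rewrite (_ : [set w | Y w \in I] = Y @^-1` [set` I])//.
by apply: measurable_funPTI; exact: measurable_itv.
Qed.

Lemma measurable_RV_gt (R : realType) (d : measure_display)
    (T : measurableType d) (P : probability T R) (Y : {RV P >-> R}) (y : R) :
  measurable [set w | y < Y w].
Proof.
have := measurable_RV_itv Y `]y, +oo[.
by congr measurable; apply/seteqP; split => w /=; rewrite in_itv/= andbT.
Qed.

Lemma integrable_truncation (R : realType) (d : measure_display)
    (T : measurableType d) (P : probability T R) (Y : {RV P >-> R}) (y : R) :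
  P.-integrable [set w | Y w \in `]0, y]] (fun w => (Y w)%:E).
Proof.
have mE := measurable_RV_itv Y `]0, y].
apply: (@le_integrable _ _ _ P _ _ _ (fun=> y%:E)) => //.
- by apply/measurable_EFinP; exact: measurable_funS (measurable_funPT Y).
- move=> w /=; rewrite in_itv/= => /andP[Y0 Yy].
  by rewrite lee_fin !ger0_norm// ltW// (lt_le_trans Y0).
- exact: finite_measure_integrable_cst.
Qed.

(** Let p = P(Y > a + B). Such a jump from x >= -a leaves the interval, and a smaller one adds at
    most c Y to W, so the mean after the step is at most (1 - p) W x + c E[Y; 0 < Y <= a + B]. Since
    W x >= G, the condition on [G] yields the loss of 1. *)
Lemma lyapunov_drift_below (R : realType) (d : measure_display)
    (T : measurableType d) (P : probability T R) (Y : {RV P >-> R})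
    (G k a B : R) :
  {ae P, forall w, 0 < Y w} -> 0 <= G -> 0 <= k -> 0 < a -> a <= B ->
  1 + k * (a + 2 * B) * \int[P]_(w in [set w | Y w \in `]0, a + B]]) Y w <=
    G * fine (ccdf Y (a + B)) ->
  let W := lyapunov G k a (2 * B) (`[-a, B[) in
  forall x, x \in `[-a, B[ -> x <= 0 ->
    (\int[P]_w (W (x + Y w))%:E + 1 <= (W x)%:E)%E.
Proof.
move=> Y0 G0 k0 a0 aB H W x xI x0.
set E := [set w | Y w \in `]0, a + B]] in H *.
have mE : measurable E by exact: measurable_RV_itv.
have iY : P.-integrable E (fun w => (Y w)%:E) by exact: integrable_truncation.
have B0 : 0 <= B by lra.
have W0 z : 0 <= W z by exact: lyapunov_ge0.
have mW : measurable_fun setT W by exact: measurable_lyapunov.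
set c := k * (a + 2 * B) in H *.
have c0 : 0 <= c by rewrite mulr_ge0//; lra.
have WG : G <= W x.
  rewrite /W /lyapunov xI lerDl !mulr_ge0//; move: xI; rewrite in_itv/=; lra.
have step y : 0 < y -> x + y \in `[-a, B[ -> W (x + y) <= W x + c * y.
  move=> y0 xyI; rewrite /W /lyapunov xI xyI /c.
  have [xa xB] : - a <= x /\ x < B by move: xI; rewrite in_itv/= => /andP[].
  have -> : G + k * ((x + a) * (2 * B - x)) + k * (a + 2 * B) * y =
      G + k * ((x + a) * (2 * B - x) + (a + 2 * B) * y) by ring.
  rewrite lerD2l ler_wpM2l//.
  (* The gap between the two sides is this product, nonnegative because x >= -a. *)
  have : 0 <= y * (2 * x + y + 2 * a) by rewrite mulr_ge0; lra.
  lra.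
pose F w := ((W x)%:E + c%:E * (Y w)%:E)%E.
have F0 w : E w -> (0 <= F w)%E.
  rewrite /E /= in_itv/= => /andP[Yw0 _]; rewrite adde_ge0 ?lee_fin//.
  by rewrite mulr_ge0// ltW.
have mF : measurable_fun E F.
  apply: emeasurable_funD => //; apply: emeasurable_funM => //.
  exact: measurable_int iY.
apply: (@le_trans _ _ (\int[P]_(w in E) F w + 1)%E).
  rewrite leeD2r// [leRHS]integral_mkcond.
  apply: ae_ge0_le_integral => //.
  - by move=> w _; rewrite lee_fin.
  - apply/measurable_EFinP; apply: measurableT_comp => //.
    exact: measurable_funD.
  - by move=> w _; apply: erestrict_ge0.
  - exact/(measurable_restrictT F mE).
  - apply: filterS Y0 => w Yw0 _; rewrite patchE.
    case: ifPn => [/set_mem|/negP wE]; rewrite /F -?EFinM -?EFinD lee_fin.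
      rewrite /E /= in_itv/= => /andP[_ YwB].
      have [xyI|xyI] := boolP (x + Y w \in `[-a, B[); first exact: step.
      rewrite /W {1}/lyapunov (negbTE xyI) -/W addr_ge0// mulr_ge0// ltW//.
    rewrite /W /lyapunov ifF//; apply/negP; rewrite in_itv/= => /andP[_ xYB].
    apply: wE; rewrite inE /E /= in_itv/= Yw0 /=.
    by move: xI; rewrite in_itv/= => /andP[xa _]; lra.
have -> : (\int[P]_(w in E) F w =
    (W x * fine (P E) + c * \int[P]_(w in E) Y w)%R%:E)%E.
  rewrite integralD//; last 2 first.
  - exact: finite_measure_integrable_cst.
  - exact: integrableZl.
  rewrite integral_cst// integralZl// EFinD (EFinM c) (EFinM (W x)).
  by rewrite /Rintegral !fineK ?fin_num_measure//; exact: integrable_fin_num.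
have EP : fine (P E) + fine (ccdf Y (a + B)) <= 1.
  have mC := measurable_RV_gt Y (a + B).
  rewrite -lee_fin EFinD !fineK ?fin_num_measure// ccdfE -measureU//.
    by apply: probability_le1; exact: measurableU.
  apply/seteqP; split => // w []; rewrite /E /= in_itv/= => /andP[_ Yw].
  by rewrite ltNge Yw.
rewrite -!EFinD lee_fin.
have : G * fine (ccdf Y (a + B)) <= W x * fine (ccdf Y (a + B)).
  by apply: ler_wpM2r => //; exact: fine_ge0.
have : W x * fine (P E) <= W x * (1 - fine (ccdf Y (a + B))).
  by rewrite ler_wpM2l//; lra.
lra.
Qed.

(** * Slowly varying tails p: growth of y p(y), and truncated means *)

Lemma doubling_ind (R : realType) (Q : R -> Prop) (y0 : R) : 0 < y0 ->
  (forall y, y0 <= y -> y < 2 * y0 -> Q y) ->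
  (forall y, 2 * y0 <= y -> Q (y / 2) -> Q y) ->
  forall y, y0 <= y -> Q y.
Proof.
move=> y00 Qbase Qstep y y0y.
have [n] : exists n : nat, y < 2 ^+ n * (2 * y0).
  exists (Num.truncn (y / (2 * y0))).+1.
  rewrite -ltr_pdivrMr; last lra.
  apply: lt_trans (truncnS_gt _) _.
  by rewrite -natrX ltr_nat ltn_expl.
elim: n y y0y => [|n IH] y y0y yn.
  by apply: Qbase => //; rewrite expr0 mul1r in yn.
have [y2|y2] := ltP y (2 * y0); first exact: Qbase.
apply: Qstep => //; apply: IH; first lra.
by rewrite exprS in yn; lra.
Qed.

Lemma near_pinfty_half (R : realType) (A : R -> Prop) :
  (\forall y \near +oo, A y) -> \forall y \near +oo, A (y / 2).
Proof.
move=> [M [_ MA]]; exists (2 * M); split; first exact: num_real.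
by move=> y My; apply: MA; lra.
Qed.

(** Pass from p to l at y/2, from l at y/2 to l at y, and from l back to p, with relative errors
    e/8. They compound to at most 1 + e because (1 + e/8)^2 <= (1 + e) (1 - e/8) for 0 < e <= 1. *)
Lemma slowly_varying_halving (R : realType) (p l : R -> R) (e : R) :
  slowly_varying l -> p x / l x @[x --> +oo] --> (1 : R) -> 0 < e -> e <= 1 ->
  \forall y \near +oo, p (y / 2) <= (1 + e) * p y.
Proof.
move=> [[a [al _]] l1] pl e0 e1.
have lpos : \forall y \near +oo, 0 < l y.
  by exists a; split => //; exact: num_real.
have half0 : 0 < 2^-1 :> R by rewrite invr_gt0.
have A : \forall y \near +oo, l (y / 2) <= (1 + e / 8) * l y.
  have e8 : 1 < 1 + e / 8 by lra.
  have H := cvgr_le _ (l1 _ half0) _ e8.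
  near=> y; have ly0 : 0 < l y by near: y.
  by rewrite [y / 2]mulrC -ler_pdivrMr//; near: y; exact: H.
have B : \forall y \near +oo, p y <= (1 + e / 8) * l y.
  have e8 : 1 < 1 + e / 8 by lra.
  have H := cvgr_le _ pl _ e8.
  near=> y; have ly0 : 0 < l y by near: y.
  by rewrite -ler_pdivrMr//; near: y; exact: H.
have C : \forall y \near +oo, (1 - e / 8) * l y <= p y.
  have e8 : 1 - e / 8 < 1 by lra.
  have H := cvgr_ge _ pl _ e8.
  near=> y; have ly0 : 0 < l y by near: y.
  by rewrite -ler_pdivlMr//; near: y; exact: H.
have B2 := near_pinfty_half B.
near=> y.
have Ay : l (y / 2) <= (1 + e / 8) * l y by near: y.
have By : p (y / 2) <= (1 + e / 8) * l (y / 2) by near: y.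
have Cy : (1 - e / 8) * l y <= p y by near: y.
have ly : 0 < l y by near: y.
apply: (le_trans By); apply: (@le_trans _ _ ((1 + e / 8) * ((1 + e / 8) * l y))).
  by rewrite ler_wpM2l//; lra.
apply: (@le_trans _ _ ((1 + e) * ((1 - e / 8) * l y))).
  rewrite !mulrA ler_wpM2r ?ltW//; nra.
by rewrite ler_wpM2l//; lra.
Unshelve. all: by end_near. Qed.

Section slowly_varying_tail.
Context {R : realType} (p : R -> R).
Hypothesis p_gt0 : forall y, 0 < p y.
Hypothesis p_mono : {homo p : x y / x <= y >-> y <= x}.
Hypothesis p_halving : forall e, 0 < e -> e <= 1 ->
  \forall y \near +oo, p (y / 2) <= (1 + e) * p y.

Lemma tail_ge0 y : 0 <= p y.
Proof. exact: ltW. Qed.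

Lemma halving_threshold (e : R) : 0 < e -> e <= 1 ->
  exists2 y0, 0 < y0 & forall y, y0 <= y -> p (y / 2) <= (1 + e) * p y.
Proof.
move=> e0 e1; have [M [_ MP]] := p_halving e0 e1.
exists (Num.max 1 (M + 1)); first by rewrite lt_max ltr01.
by move=> y; rewrite ge_max => /andP[_ My]; apply: MP; lra.
Qed.

Lemma mul_tail_pinfty (M : R) : \forall y \near +oo, M <= y * p y.
Proof.
have e0 : 0 < 5^-1 :> R by rewrite invr_gt0.
have e1 : 5^-1 <= 1 :> R by lra.
have [y0 y00 Hp] := halving_threshold e0 e1.
(* As [p] is nonincreasing, this bounds y p(y)^2 from below on [y0, 2 y0[. *)
pose m := y0 * p (2 * y0) ^+ 2.
have m0 : 0 < m by rewrite mulr_gt0// exprn_gt0.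
(* p loses at most a factor 6/5 < sqrt 2 per doubling, so y p(y)^2 increases
   along doublings. *)
have H : forall y, y0 <= y -> m <= y * p y ^+ 2.
  apply: doubling_ind => // [y y0y y2|y y2 IH].
    apply: ler_pM => //; [exact: ltW|exact: sqr_ge0|].
    by rewrite lerXn2r ?nnegrE ?tail_ge0//; apply: p_mono; exact: ltW.
  apply: (le_trans IH).
  have pp : p (y / 2) <= (1 + 5^-1) * p y by apply: Hp; lra.
  have : p (y / 2) ^+ 2 <= ((1 + 5^-1) * p y) ^+ 2.
    by rewrite lerXn2r ?nnegrE ?tail_ge0// mulr_ge0 ?tail_ge0//; lra.
  rewrite exprMn => pp2.
  have : 0 <= p y ^+ 2 by exact: sqr_ge0.
  have : y / 2 * p (y / 2) ^+ 2 <= y / 2 * ((1 + 5^-1) ^+ 2 * p y ^+ 2).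
    by rewrite ler_wpM2l//; lra.
  have -> : y / 2 * ((1 + 5^-1) ^+ 2 * p y ^+ 2) =
    (1 + 5^-1) ^+ 2 / 2 * (y * p y ^+ 2) by ring.
  move=> h p2; apply: (le_trans h).
  rewrite -[leRHS]mul1r ler_wpM2r//; last by lra.
  by rewrite mulr_ge0//; lra.
near=> y.
have yp : 0 <= y * p y by rewrite mulr_ge0 ?ltW//; near: y; exact: nbhs_pinfty_gt.
apply: (le_trans (ler_norm M)); rewrite -[leRHS]ger0_norm// -ler_sqr ?nnegrE//.
rewrite !real_normK ?num_real// exprMn.
have ym : m <= y * p y ^+ 2 by apply: H; near: y; apply: nbhs_pinfty_ge; exact: num_real.
have yM : M ^+ 2 / m <= y by near: y; apply: nbhs_pinfty_ge; exact: num_real.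
(* Thus (y p(y))^2 is at least m y, which exceeds M^2 once y >= M^2 / m. *)
have -> : y ^+ 2 * p y ^+ 2 = y * (y * p y ^+ 2) by ring.
rewrite -(divfK (lt0r_neq0 m0) (M ^+ 2)); apply: ler_pM => //; last exact: ltW.
by apply: divr_ge0; [exact: sqr_ge0 | exact: ltW].
Unshelve. all: by end_near. Qed.

(** [mu] stands for E[Y; 0 < Y <= y]. The layer ]y/2, y] adds at most f y p(y), while y p(y) grows
    by a factor at least 2 / (1 + f) per doubling; the layers therefore sum like a geometric
    series. *)
Lemma truncated_mean_negligible (mu : R -> R) (e : R) :
  (forall y, 0 <= y -> mu y <= y) ->
  (forall y, 0 <= y -> mu y <= mu (y / 2) + y * (p (y / 2) - p y)) -> 0 < e ->
  \forall y \near +oo, mu y <= e * (y * p y).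
Proof.
move=> mu_le mu_half e0.
(* The induction produces 4 f and closes when 2 f <= 1; one further f absorbs the constant 2 y0, as
   y p(y) tends to infinity. Hence 5 f <= e. *)
pose f := Num.min (e / 5) 2^-1.
have f0 : 0 < f by rewrite lt_min divr_gt0//= invr_gt0.
have f2 : f <= 2^-1 by rewrite ge_min lexx orbT.
have fe : f <= e / 5 by rewrite ge_min lexx.
have f1 : f <= 1 by lra.
have [y0 y00 Hp] := halving_threshold f0 f1.
have H : forall y, y0 <= y -> mu y <= 4 * f * (y * p y) + 2 * y0.
  apply: doubling_ind => // [y y0y y2|y y2 IH].
    have := mu_le y; have : 0 <= 4 * f * (y * p y).
      by rewrite !mulr_ge0 ?tail_ge0//; lra.
    lra.
  have yge0 : 0 <= y by lra.
  have := mu_half y yge0.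
  have pp : p (y / 2) <= (1 + f) * p y by apply: Hp; lra.
  have h1 : y * (p (y / 2) - p y) <= y * (f * p y) by rewrite ler_wpM2l//; lra.
  have h2 : 2 * f * (y * p (y / 2)) <= 2 * f * (y * ((1 + f) * p y)).
    by rewrite ler_wpM2l//; [lra | rewrite ler_wpM2l].
  have h3 : 0 <= f * (y * p y) * (1 - 2 * f).
    by apply: mulr_ge0; [rewrite !mulr_ge0 ?tail_ge0// ltW | lra].
  lra.
near=> y.
have y0y : y0 <= y by near: y; apply: nbhs_pinfty_ge; exact: num_real.
have h1 : mu y <= 4 * f * (y * p y) + 2 * y0 by exact: H.
have h2 : 2 * y0 / f <= y * p y by near: y; exact: mul_tail_pinfty.
have h3 : 2 * y0 <= f * (y * p y) by rewrite [f * _]mulrC -ler_pdivrMr.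
have h4 : f * (y * p y) <= e / 5 * (y * p y).
  by rewrite ler_wpM2r// mulr_ge0 ?tail_ge0//; lra.
lra.
Unshelve. all: by end_near. Qed.

End slowly_varying_tail.

(** * Truncated first and second moments *)

Lemma le_Rintegral_cst (R : realType) (d : measure_display) (T : measurableType d)
    (P : probability T R) (D : set T) (f : T -> R) (y : R) : measurable D ->
  P.-integrable D (fun w => (f w)%:E) -> (forall w, D w -> f w <= y) ->
  \int[P]_(w in D) f w <= y * fine (P D).
Proof.
move=> mD fi fy; rewrite -(Rintegral_cst P mD); apply: le_Rintegral => //.
exact: finite_measure_integrable_cst.
Qed.

Lemma truncated_mean_le (R : realType) (d : measure_display)
    (T : measurableType d) (P : probability T R) (Y : {RV P >-> R}) (y : R) :
  0 <= y -> \int[P]_(w in [set w | Y w \in `]0, y]]) Y w <= y.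
Proof.
move=> y0; have mE := measurable_RV_itv Y `]0, y].
apply: (@le_trans _ _ (y * fine (P [set w | Y w \in `]0, y]]))).
  apply: le_Rintegral_cst => //; first exact: integrable_truncation.
  by move=> w /=; rewrite in_itv/= => /andP[].
rewrite -[leRHS]mulr1 ler_wpM2l// -lee_fin fineK ?fin_num_measure//.
exact: probability_le1.
Qed.

(** On the layer ]y/2, y] the variable is at most y, and the probability of the layer is the
    difference of the two tails. *)
Lemma truncated_mean_halving (R : realType) (d : measure_display)
    (T : measurableType d) (P : probability T R) (Y : {RV P >-> R}) (y : R) :
  0 <= y -> \int[P]_(w in [set w | Y w \in `]0, y]]) Y w <=
    \int[P]_(w in [set w | Y w \in `]0, y / 2]]) Y w +
      y * (fine (ccdf Y (y / 2)) - fine (ccdf Y y)).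
Proof.
move=> y0.
have m1 := measurable_RV_itv Y `]0, y / 2].
have m2 := measurable_RV_itv Y `]y / 2, y].
have m3 := measurable_RV_itv Y `]0, y].
set E1 := [set w | Y w \in `]0, y / 2]] in m1 *.
set E2 := [set w | Y w \in `]y / 2, y]] in m2 *.
have EU : [set w | Y w \in `]0, y]] = E1 `|` E2.
  apply/seteqP; split => w; rewrite /E1 /E2 /= !in_itv/=.
    move=> /andP[Y0 Yy]; have [Yh|Yh] := leP (Y w) (y / 2); first by left; rewrite Y0.
    by right.
  by case=> /andP[Y1 Y2]; apply/andP; split; lra.
have iY := integrable_truncation Y y.
rewrite EU in iY *.
rewrite Rintegral_setU//; last first.
  rewrite disj_set2E; apply/eqP/seteqP; split => // w []; rewrite /E1 /E2 /= !in_itv/=.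
  by move=> /andP[_ Y1] /andP[Y2 _]; move: (lt_le_trans Y2 Y1); rewrite ltxx.
rewrite lerD2l.
have -> : fine (ccdf Y (y / 2)) - fine (ccdf Y y) = fine (P E2).
  have mC := measurable_RV_gt Y y.
  have -> : ccdf Y (y / 2) = (P E2 + ccdf Y y)%E.
    rewrite !ccdfE -measureU//.
      congr (P _); apply/seteqP; split => w; rewrite /E2 /= in_itv/=.
        by move=> Yh; have [Yy|Yy] := leP (Y w) y; [left; rewrite Yh | right].
      by case=> [/andP[]//|]; lra.
    apply/seteqP; split => // w []; rewrite /E2 /= in_itv/= => /andP[_ Yw].
    by rewrite ltNge Yw.
  by rewrite fineD ?fin_num_measure// ?ccdfE ?fin_num_measure// addrK.
apply: le_Rintegral_cst => //.
  by apply: integrableS iY => //; exact: measurableU.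
by move=> w; rewrite /E2 /= in_itv/= => /andP[].
Qed.

(** Dominated convergence with bound X^2: at each point the restricted square vanishes once u n >=
    |X|. *)
Lemma second_moment_tail (R : realType) (d : measure_display)
    (T : measurableType d) (P : probability T R) (X : {RV P >-> R})
    (u : nat -> R) (e : R) :
  (\int[P]_w (X w ^+ 2)%:E < +oo)%E -> u n @[n --> \oo] --> +oo -> 0 < e ->
  \forall n \near \oo,
    (\int[P]_(w in [set w | (u n < `|X w|)%R]) (X w ^+ 2)%:E <= e%:E)%E.
Proof.
move=> X2 uoo e0.
pose A n := [set w | u n < `|X w|].
have mA n : measurable (A n) by exact: measurable_norm_gt.
have iX2 := integrable_sqr_ltey X2.
have : (\int[P]_w ((fun w => (X w ^+ 2)%:E) \_ (A n)) w)%E @[n --> \oo] -->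
    (\int[P]_w (cst 0%E w : \bar R))%E.
  apply: (@dominated_cvg _ _ _ P setT _ _ _ (fun w => (X w ^+ 2)%:E)) => //.
  - by move=> n; apply/(measurable_restrictT _ (mA n)); exact: measurable_funTS (measurable_int _ iX2).
  - move=> w _; apply: cvg_near_cst; near=> n; rewrite patchE ifF//.
    apply/negP; rewrite inE /A /= ltNge; apply/negP/negPn; near: n.
    by move/cvgryPge : uoo; exact.
  - move=> n w _; rewrite patchE; case: ifP => _; last by rewrite abse0 lee_fin sqr_ge0.
    by rewrite gee0_abs// lee_fin sqr_ge0.
rewrite integral0 => /fine_cvgP[Hfin Hcvg]; have He := cvgr_le _ Hcvg _ e0.
near=> n; rewrite [leLHS]integral_mkcond -/(A n).
have fn : (\int[P]_w ((fun w => (X w ^+ 2)%:E) \_ (A n)) w)%E \is a fin_num.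
  by near: n.
by rewrite -(fineK fn) lee_fin; near: n; exact: He.
Unshelve. all: by end_near. Qed.

(** * The probability of staying below a level of order sqrt n *)

(** A step by [x k] starts from a positive position and descends by at most [a]; a step by [y k]
    goes up. So the walk never passes below -a, and the killed walk coincides with it. *)
Lemma killed_walk_confined (R : realType) (a B : R) (x y : nat -> R) (n : nat) :
  0 <= a -> 0 < B -> (forall k, (k < n)%N -> `|x k| <= a) ->
  (forall k, (k < n)%N -> 0 < y k) ->
  (forall k, (k <= n)%N -> walk x y k < B) ->
  killed_walk `[-a, B[ x y n \in `[-a, B[.
Proof.
move=> a0 B0 xa y0 wB.
suff H k : (k <= n)%N -> - a <= walk x y k /\ killed_walk `[-a, B[ x y k = walk x y k.
  by have [wa ->] := H n (leqnn n); rewrite in_itv/= wa wB.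
elim: k => [|k IH] kn; first by rewrite /= oppr_le0.
have [wa kw] := IH (ltnW kn).
have wI : walk x y k \in `[-a, B[ by rewrite in_itv/= wa wB// ltnW.
rewrite /= kw wI; split=> //.
case: ifPn => [w0|_]; last by have := y0 k kn; lra.
have := xa k kn; rewrite ler_norml => /andP[xl _]; lra.
Qed.

Lemma measurable_walk (R : realType) (d : measure_display)
    (T : measurableType d) (P : probability T R) (X Y : nat -> {RV P >-> R})
    (k : nat) : measurable_fun setT (fun w => walk (X ^~ w) (Y ^~ w) k).
Proof.
elim: k => [|k IH] /=; first exact: measurable_cst.
apply: measurable_funD => //; apply: measurable_fun_ifT => //.
exact: measurable_fun_ltr.
Qed.

Lemma measurable_walk_below (R : realType) (d : measure_display)
    (T : measurableType d) (P : probability T R) (X Y : nat -> {RV P >-> R})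
    (B : R) (n : nat) :
  measurable [set w | forall k, (k <= n)%N -> walk (X ^~ w) (Y ^~ w) k < B].
Proof.
rewrite (_ : mkset _ = \bigcap_(k in [set k | (k <= n)%N])
    ((fun w => walk (X ^~ w) (Y ^~ w) k) @^-1` `]-oo, B[%classic)); last first.
  apply/seteqP; split => w /= H k kn; first by rewrite /= in_itv/= H.
  by have := H k kn; rewrite /= in_itv.
apply: bigcap_measurableType => k _; rewrite -[_ @^-1` _]setTI.
exact: measurable_walk.
Qed.

(** If the walk stays below [B], either the killed walk survives up to time [n], which
    [killed_walk_survival] controls, or one of the first [n] increments is exceptional, which a
    union bound controls. *)
Lemma confinement_bound (R : realType) (d : measure_display)
    (T : measurableType d) (P : probability T R) (X Y : nat -> {RV P >-> R})
    (sigma a B : R) (n : nat) :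
  iid X -> iid Y -> independent_sequences X Y ->
  'E_P[X 0%N]%E = 0%E -> 0 < sigma ->
  'E_P[fun w => (X 0%N w ^+ 2)%R]%E = (sigma ^+ 2)%:E ->
  (forall n, {ae P, forall w, 0 < Y n w}) -> 0 < a -> a <= B ->
  ((1 + 2 * B / a)%:E * \int[P]_(w in [set w | (a < `|X 0%N w|)%R])
     (X 0%N w ^+ 2)%:E <= (sigma ^+ 2 / 2)%:E)%E ->
  0 < fine (ccdf (Y 0%N) (a + B)) ->
  n%:R * fine (P [set w | forall k, (k <= n)%N -> walk (X ^~ w) (Y ^~ w) k < B]) <=
    (1 + 2 / sigma ^+ 2 * (a + 2 * B) *
       \int[P]_(w in [set w | Y 0%N w \in `]0, a + B]]) Y 0%N w) /
      fine (ccdf (Y 0%N) (a + B)) + 2 / sigma ^+ 2 * (a * (2 * B)) +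
    n%:R * (n%:R * fine (P [set w | a < `|X 0%N w|])).
Proof.
move=> iX iY XY X1 s0 X2 Y0 a0 aB tailX p0.
have B0 : 0 < B by lra.
set m := \int[P]_(w in _) _ w; set p := fine (ccdf _ _) in p0 *.
set k := 2 / sigma ^+ 2.
have k0 : 0 < k by rewrite divr_gt0// exprn_gt0.
have kge0 := ltW k0; have B0' := ltW B0.
have m0 : 0 <= m.
  by apply: Rintegral_ge0 => w /=; rewrite in_itv/= => /andP[/ltW].
(* The value that turns the condition of [lyapunov_drift_below] into an equality. *)
pose G := (1 + k * (a + 2 * B) * m) / p.
have aB0 : 0 <= a + 2 * B by lra.
have kB0 : 0 <= k * (a + 2 * B) * m by rewrite mulr_ge0// mulr_ge0.
have G0 : 0 <= G.
  by apply: divr_ge0; [rewrite addr_ge0 | exact: ltW].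
pose I := `[-a, B[.
pose K := [set w | killed_walk I (X ^~ w) (Y ^~ w) n \in I].
have HK : (n%:R%:E * P K <= (G + k * (a * (2 * B)))%:E)%E.
  have -> : (G + k * (a * (2 * B))) = lyapunov G k a (2 * B) I 0.
    by rewrite /lyapunov in_itv/= ifT ?add0r ?subr0// B0 andbT; lra.
  apply: killed_walk_survival => //.
  - exact: measurable_lyapunov.
  - by move=> x; apply: lyapunov_ge0.
  - by move=> x /negbTE xI; rewrite /lyapunov xI.
  - exact: (@lyapunov_drift_above _ _ _ P (X 0%N) sigma G a B).
  - apply: lyapunov_drift_below => //.
    by rewrite /G divfK// gt_eqF.
have mK : measurable K.
  rewrite /K (_ : mkset _ = (fun w => killed_walk I (X ^~ w) (Y ^~ w) n) @^-1` [set` I])//.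
  by rewrite -[_ @^-1` _]setTI; apply: measurable_killed_walk.
(* Including the null event that [Y i] is nonpositive makes the inclusion [AKU] hold at every point
   rather than almost surely. *)
pose U i := [set w | a < `|X i w|] `|` [set w | Y i w \in `]-oo, 0]].
have mX i : measurable [set w | a < `|X i w|] by exact: measurable_norm_gt.
have mU i : measurable (U i) by apply: measurableU => //; exact: measurable_RV_itv.
have PU i : P (U i) = P [set w | a < `|X 0%N w|].
  transitivity (P [set w | a < `|X i w|]); last first.
    exact: (congr1 (fun m => m [set x | a < `|x|]) (proj2 iX i)).
  apply: measureU0 => //; first exact: measurable_RV_itv.
  apply/negligibleP; first exact: measurable_RV_itv.
  apply: negligibleS (Y0 i) => w /=; rewrite in_itv/= => Yi Yi0.
  by move: (lt_le_trans Yi0 Yi); rewrite ltxx.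
pose A := [set w | forall k, (k <= n)%N -> walk (X ^~ w) (Y ^~ w) k < B].
have AKU : A `<=` K `|` \big[setU/set0]_(i < n) U i.
  move=> w Aw; rewrite /K /=.
  have [Uw|Uw] := pselect ((\big[setU/set0]_(i < n) U i) w); first by right.
  left; have {}Uw i : (i < n)%N -> ~ U i w.
    by move=> ik Uiw; apply: Uw; rewrite -bigcup_mkord; exists i.
  apply: killed_walk_confined => //; first exact: ltW.
    by move=> i /Uw Ui; rewrite leNgt; apply/negP => h; apply: Ui; left.
  move=> i /Uw Ui; rewrite ltNge; apply/negP => h; apply: Ui; right.
  by rewrite /= in_itv.
have mA : measurable A by exact: measurable_walk_below.
have mUn : measurable (\big[setU/set0]_(i < n) U i).
  by apply: bigsetU_measurable.
have fP D : measurable D -> P D = (fine (P D))%:E.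
  by move=> mD; rewrite fineK// fin_num_measure.
have PUn : (P (\big[setU/set0]_(i < n) U i) <= n%:R%:E * P [set w | (a < `|X 0%N w|)%R])%E.
  apply: (@le_trans _ _ (\sum_(i < n) P (U i))%E); first exact: Boole_inequality.
  under eq_bigr do rewrite PU (fP _ (mX 0%N)).
  by rewrite sumEFin sumr_const card_ord (fP _ (mX 0%N)) -EFinM mulr_natl.
have PA : (P A <= P K + n%:R%:E * P [set w | (a < `|X 0%N w|)%R])%E.
  apply: (@le_trans _ _ (P K + P (\big[setU/set0]_(i < n) U i))%E).
    apply: le_trans (measureU2 _ mK mUn).
    by apply: le_measure; rewrite ?inE//; exact: measurableU.
  exact: leeD2l.
rewrite (fP _ mA) (fP _ mK) (fP _ (mX 0%N)) -EFinM -EFinD lee_fin in PA.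
rewrite (fP _ mK) -EFinM lee_fin in HK.
rewrite -/A -/G; apply: le_trans (ler_wpM2l (ler0n R n) PA) _.
by rewrite mulrDr lerD2r.
Qed.

Lemma cvg_sqrt_nat_pinfty (R : realType) (h : R) : 0 < h ->
  h * Num.sqrt n%:R @[n --> \oo] --> +oo.
Proof.
move=> h0; apply/cvgryPge => M; near=> n.
rewrite mulrC -ler_pdivrMr//; apply: (le_trans (ler_norm _)).
rewrite -ler_sqr ?nnegrE ?sqrtr_ge0// sqr_sqrtr//.
near: n; exact: nbhs_infty_ger.
Unshelve. all: by end_near. Qed.

(** Keeping the truncated second moment on the right makes n P(|X| > a) tend to 0 for a of order
    sqrt n, where the full moment would only bound it. *)
Lemma chebyshev_tail (R : realType) (d : measure_display)
    (T : measurableType d) (P : probability T R) (X : {RV P >-> R}) (a : R) :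
  0 <= a ->
  ((a ^+ 2)%:E * P [set w | (a < `|X w|)%R] <=
    \int[P]_(w in [set w | (a < `|X w|)%R]) (X w ^+ 2)%:E)%E.
Proof.
move=> a0; have mA := measurable_norm_gt X a; rewrite -integral_cst//; apply: ge0_le_integral => //.
- by move=> w _; rewrite lee_fin sqr_ge0.
- by apply/measurable_EFinP; apply: measurable_funTS; exact: measurable_funX.
- by move=> w /= aX; rewrite lee_fin -(real_normK (num_real (X w))) ler_sqr ?nnegrE// ltW.
Qed.

Lemma fine_ccdf_nonincreasing (R : realType) (d : measure_display)
    (T : measurableType d) (P : probability T R) (Y : {RV P >-> R}) :
  {homo (fun y => fine (ccdf Y y)) : x y / x <= y >-> y <= x}.
Proof.
have ccdf_fin y : ccdf Y y \is a fin_num.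
  by rewrite ccdfE fin_num_measure//; exact: measurable_RV_gt.
move=> x y xy; rewrite -lee_fin !fineK// !ccdfE.
apply: le_measure; rewrite ?inE; [exact: measurable_RV_gt..|].
by move=> w /=; exact: le_lt_trans.
Qed.

(** The ratio is eventually positive, so the tail is positive at arbitrarily large points, hence
    everywhere by monotonicity. *)
Lemma slowly_varying_ccdf_gt0 (R : realType) (d : measure_display)
    (T : measurableType d) (P : probability T R) (Y : {RV P >-> R})
    (l : R -> R) (y : R) :
  slowly_varying l -> fine (ccdf Y x) / l x @[x --> +oo] --> (1 : R) ->
  0 < fine (ccdf Y y).
Proof.
move=> [[a [al _]] _] pl.
have p_pos : \forall x \near +oo, 0 < fine (ccdf Y x) / l x.
  exact: (cvgr_gt _ pl).
have [x [yx px]] : exists x, y <= x /\ 0 < fine (ccdf Y x).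
  near (@pinfty_nbhs R) => x; exists x; split.
    by near: x; apply: nbhs_pinfty_ge; exact: num_real.
  have lx : 0 < l x.
    by apply: al; near: x; apply: nbhs_pinfty_gt; exact: num_real.
  by rewrite -(pmulr_lgt0 _ (_ : 0 < (l x)^-1)) ?invr_gt0//; near: x.
exact: lt_le_trans px (fine_ccdf_nonincreasing Y yx).
Unshelve. all: by end_near. Qed.

(** [confinement_bound] is applied with a = del sqrt n and B = c sqrt n up to the integer part N of
    n t; each of its three terms is at most N e / 3. *)
Lemma walk_below_cvg0 (R : realType) (d : measure_display) (T : measurableType d)
    (P : probability T R) (X Y : nat -> {RV P >-> R}) (sigma : R)
    (l : R -> R) (t c e : R) :
  iid X -> iid Y -> independent_sequences X Y ->
  'E_P[X 0%N]%E = 0%E -> 0 < sigma ->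
  'E_P[fun w => (X 0%N w ^+ 2)%R]%E = (sigma ^+ 2)%:E ->
  (forall n, {ae P, forall w, 0 < Y n w}) ->
  slowly_varying l ->
  fine (ccdf (Y 0%N) x) / l x @[x --> +oo] --> (1 : R) ->
  0 < t -> 0 < c -> 0 < e ->
  \forall n \near \oo,
    fine (P [set w | forall k, (k <= Num.truncn (n%:R * t))%N ->
      walk (X ^~ w) (Y ^~ w) k < c * Num.sqrt n%:R]) <= e.
Proof.
move=> iX iY XY X1 s0 X2 Y0 lsv pl t0 c0 e0.
pose p y := fine (ccdf (Y 0%N) y).
pose mu y := \int[P]_(w in [set w | Y 0%N w \in `]0, y]]) Y 0%N w.
have p_mono : {homo p : x y / x <= y >-> y <= x}.
  exact: fine_ccdf_nonincreasing.
have p_gt0 y : 0 < p y by exact: slowly_varying_ccdf_gt0 lsv pl.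
have p_half f : 0 < f -> f <= 1 -> \forall y \near +oo, p (y / 2) <= (1 + f) * p y.
  by move=> f0 f1; exact: slowly_varying_halving lsv pl f0 f1.
have s20 : 0 < sigma ^+ 2 by rewrite exprn_gt0.
pose k := 2 / sigma ^+ 2.
have k0 : 0 < k by rewrite divr_gt0.
(* The first bound gives a <= B. The second handles the term 2 k a B = 2 k c del n, using n t <= 2
   N. *)
pose del := Num.min c (e * t / (12 * k * c)).
have del0 : 0 < del by rewrite lt_min c0 divr_gt0// mulr_gt0// mulr_gt0.
have delc : del <= c by rewrite ge_min lexx.
have kc0 : 0 < 12 * k * c by rewrite mulr_gt0// mulr_gt0.
have dele : 12 * k * c * del <= e * t.
  by rewrite mulrC -ler_pdivlMr// ge_min lexx orbT.
pose h := del + c.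
have h0 : 0 < h by apply: addr_gt0.
(* Chosen so that f (1 + 2 k) h^2 n = e t n / 6, which is at most N e / 3. *)
pose f := e * t / (6 * (1 + 2 * k) * h ^+ 2).
have f0 : 0 < f.
  rewrite /f divr_gt0//; first exact: mulr_gt0.
  by rewrite mulr_gt0 ?exprn_gt0// mulr_gt0// addr_gt0// mulr_gt0.
have mu_small : \forall y \near +oo, mu y <= f * (y * p y).
  apply: truncated_mean_negligible => // y y0.
    exact: truncated_mean_le.
  exact: truncated_mean_halving.
(* This bounds the part 1 / p(y) of G by f y^2, of order n at y = h sqrt n. *)
have yp_big : \forall y \near +oo, 1 <= f * (y * (y * p y)).
  near=> y; have y1 : 1 <= y by near: y; apply: nbhs_pinfty_ge; exact: num_real.
  have ypf : f^-1 <= y * p y by near: y; exact: mul_tail_pinfty.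
  have yp1 : y * p y <= y * (y * p y).
    by rewrite ler_peMl// mulr_ge0 ?tail_ge0//; lra.
  rewrite [f * _]mulrC -ler_pdivrMr// div1r; exact: le_trans yp1.
have hoo := cvg_sqrt_nat_pinfty h0.
have deloo := cvg_sqrt_nat_pinfty del0.
have X2oo : (\int[P]_w (X 0%N w ^+ 2)%:E < +oo)%E.
  by move: X2; rewrite unlock => ->; rewrite ltry.
(* The first bound gives the tail condition for the drift above 0; the second gives n t P(|X| > a)
   <= e / 3 through Chebyshev. *)
pose tau := Num.min (sigma ^+ 2 / 2 / (1 + 2 * c / del)) (e * del ^+ 2 / (3 * t)).
have cd0 : 0 < 1 + 2 * c / del by rewrite addr_gt0// divr_gt0// mulr_gt0.
have tau0 : 0 < tau by rewrite lt_min !divr_gt0 ?mulr_gt0 ?exprn_gt0.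
have tail_small := second_moment_tail X2oo deloo tau0.
near=> n.
have tl : (\int[P]_(w in [set w | (del * Num.sqrt n%:R < `|X 0%N w|)%R])
    (X 0%N w ^+ 2)%:E <= tau%:E)%E.
  by near: n; exact: tail_small.
have muy : mu (h * Num.sqrt n%:R) <=
    f * (h * Num.sqrt n%:R * p (h * Num.sqrt n%:R)).
  by near: n; exact: (hoo _ mu_small).
have ypy : 1 <= f * (h * Num.sqrt n%:R * (h * Num.sqrt n%:R *
    p (h * Num.sqrt n%:R))).
  by near: n; exact: (hoo _ yp_big).
set r := Num.sqrt n%:R in tl muy ypy *.
have n0 : 0 < n%:R :> R by rewrite ltr0n; near: n; exists 1%N.
have r0 : 0 < r by rewrite sqrtr_gt0.
have r2 : r ^+ 2 = n%:R by rewrite sqr_sqrtr// ltW.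
set N := Num.truncn _.
have N1 : N%:R <= n%:R * t by rewrite truncn_le// mulr_ge0 ?ltW.
have N2 : n%:R * t / 2 <= N%:R.
  have := truncnS_gt (n%:R * t); rewrite -/N -natr1 => Nt.
  have : 2 <= n%:R * t by rewrite -ler_pdivrMr//; near: n; exact: nbhs_infty_ger.
  lra.
have N0 : 0 < N%:R :> R by apply: lt_le_trans N2; rewrite divr_gt0 ?mulr_gt0.
set PA := fine _.
pose a := del * r; pose B := c * r.
have a0 : 0 < a by rewrite mulr_gt0.
have aB : a <= B by rewrite ler_wpM2r// ltW.
have aBh : a + B = h * r by rewrite /a /B -mulrDl.
have mA := measurable_norm_gt (X 0%N) a.
have tl1 : ((1 + 2 * B / a)%:E * \int[P]_(w in [set w | (a < `|X 0%N w|)%R])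
     (X 0%N w ^+ 2)%:E <= (sigma ^+ 2 / 2)%:E)%E.
  have -> : 2 * B / a = 2 * c / del.
    by rewrite /B /a; field; rewrite !gt_eqF.
  apply: le_trans (lee_wpmul2l _ tl) _; first by rewrite lee_fin ltW.
  by rewrite -EFinM lee_fin mulrC -ler_pdivlMr// ge_min lexx.
have bound := confinement_bound N iX iY XY X1 s0 X2 Y0 a0 aB tl1 (p_gt0 (a + B)).
set q := fine (P [set w | a < `|X 0%N w|]) in bound.
have q0 : 0 <= q by exact: fine_ge0.
have qtau : a ^+ 2 * q <= tau.
  rewrite -lee_fin EFinM fineK ?fin_num_measure//.
  exact: le_trans (chebyshev_tail (X 0%N) (ltW a0)) tl.
have Nq : N%:R * q <= e / 3.
  have tau3 : tau <= e * del ^+ 2 / (3 * t) by rewrite ge_min lexx orbT.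
  have : del ^+ 2 * (n%:R * t * q) <= del ^+ 2 * (e / 3).
    have -> : del ^+ 2 * (e / 3) = t * (e * del ^+ 2 / (3 * t)).
      by field; rewrite gt_eqF.
    have -> : del ^+ 2 * (n%:R * t * q) = t * (a ^+ 2 * q).
      by rewrite /a exprMn r2; ring.
    by apply: ler_wpM2l; [exact: ltW|exact: le_trans tau3].
  rewrite ler_pM2l ?exprn_gt0//; apply: le_trans.
  by rewrite ler_wpM2r.
rewrite aBh -/(mu (h * r)) -/(p (h * r)) in bound.
have hr0 : 0 < h * r by rewrite mulr_gt0.
rewrite -(ler_pM2l N0); apply: (le_trans bound).
have N3 : n%:R * t <= 2 * N%:R by lra.
have b1 : 2 / sigma ^+ 2 * (a * (2 * B)) <= N%:R * (e / 3).
  rewrite -/k /a /B.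
  have -> : k * (del * r * (2 * (c * r))) = 12 * k * c * del * r ^+ 2 / 6 by field.
  rewrite r2.
  have : 12 * k * c * del * n%:R <= e * t * n%:R by rewrite ler_wpM2r// ltW.
  have : e * (n%:R * t) <= e * (2 * N%:R) by rewrite ler_wpM2l// ltW.
  lra.
have b2 : N%:R * (N%:R * q) <= N%:R * (e / 3) by rewrite ler_wpM2l// ltW.
have b3 : (1 + 2 / sigma ^+ 2 * (a + 2 * B) * mu (h * r)) / p (h * r) <= N%:R * (e / 3).
  rewrite ler_pdivrMr// -/k.
  have c1 : k * (a + 2 * B) * mu (h * r) <= k * (2 * (h * r)) * (f * (h * r * p (h * r))).
    apply: ler_pM => //.
    - by rewrite mulr_ge0 ?ltW// addr_gt0// mulr_gt0// (lt_le_trans a0).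
    - by apply: Rintegral_ge0 => w /=; rewrite in_itv/= => /andP[/ltW].
    - by rewrite ler_wpM2l ?ltW// -aBh; lra.
  apply: le_trans (lerD ypy c1) _.
  have -> : f * (h * r * (h * r * p (h * r))) + k * (2 * (h * r)) * (f * (h * r * p (h * r)))
      = e * t / 6 * (n%:R * p (h * r)).
    rewrite -r2 /f; field; rewrite gt_eqF//=.
    by rewrite gt_eqF// addr_gt0// mulr_gt0.
  have : e / 6 * p (h * r) * (n%:R * t) <= e / 6 * p (h * r) * (2 * N%:R).
    by apply: ler_wpM2l => //; rewrite mulr_ge0 ?divr_ge0 ?ltW.
  lra.
lra.
Unshelve. all: by end_near. Qed.

(** * The maximum of the rescaled walk *)

Lemma rescaled_max_lt (R : realType) (x y : nat -> R) (n : nat) (t c : R) :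
  (0 < n)%N -> 0 <= t ->
  ~~ (c <= rescaled_max x y n t) <->
  forall k, (k <= Num.truncn (n%:R * t))%N -> walk x y k < c * Num.sqrt n%:R.
Proof.
move=> n0 t0; rewrite -ltNge; set r := Num.sqrt n%:R; set N := Num.truncn _.
have n0' : 0 < n%:R :> R by rewrite ltr0n.
have r0 : 0 < r by rewrite sqrtr_gt0.
(* This finite maximum serves twice: it shows that the set has a supremum, and it keeps the
   inequality strict when passing to that supremum. *)
pose m := \big[Num.max/walk x y 0 / r]_(k < N.+1) (walk x y k / r).
have ubm : ubound [set walk_at x y (n%:R * s) / r | s in `[0, t]] m.
  move=> z [s + <-]; rewrite /= in_itv/= => /andP[s0 st]; rewrite /walk_at.
  have kN : (Num.truncn (n%:R * s) < N.+1)%N.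
    by rewrite ltnS; apply: le_truncn; rewrite ler_wpM2l.
  exact: (le_bigmax _ (fun k : 'I_N.+1 => walk x y k / r) (Ordinal kN)).
split=> [H k kN|H].
  rewrite -ltr_pdivrMr//; apply: le_lt_trans H.
  apply: ub_le_sup; first by exists m.
  exists (k%:R / n%:R).
    rewrite /= in_itv/= divr_ge0//= ler_pdivrMr// mulrC.
    by move: kN; rewrite /N truncn_ge_nat// mulr_ge0.
  have -> : n%:R * (k%:R / n%:R) = k%:R :> R by rewrite mulrC divfK// gt_eqF.
  by rewrite /walk_at natrK.
apply: (@le_lt_trans _ _ m).
  apply: ge_sup => //; exists (walk_at x y (n%:R * 0) / r); exists 0 => //.
  by rewrite /= in_itv/= lexx.
apply: bigmax_lt => [|k _]; rewrite ltr_pdivrMr//; first exact: (H 0%N).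
by apply: H; rewrite -ltnS.
Qed.

Lemma rescaled_max_ge_cvg1 (R : realType) (d : measure_display)
    (T : measurableType d) (P : probability T R) (X Y : nat -> {RV P >-> R})
    (t c : R) : 0 <= t ->
  (forall e, 0 < e -> \forall n \near \oo,
    fine (P [set w | forall k, (k <= Num.truncn (n%:R * t))%N ->
      walk (X ^~ w) (Y ^~ w) k < c * Num.sqrt n%:R]) <= e) ->
  P [set w | c <= rescaled_max (X ^~ w) (Y ^~ w) n t] @[n --> \oo] --> 1%E.
Proof.
move=> t0 H.
pose A n := [set w | forall k, (k <= Num.truncn (n%:R * t))%N ->
  walk (X ^~ w) (Y ^~ w) k < c * Num.sqrt n%:R].
have mA n : measurable (A n) by exact: measurable_walk_below.
have E n : (0 < n)%N ->
    [set w | c <= rescaled_max (X ^~ w) (Y ^~ w) n t] = ~` A n.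
  move=> n0; apply/seteqP; split => w /=.
    by move=> h /(rescaled_max_lt _ _ _ n0 t0)/negP; apply.
  move=> h; apply/negPn/negP => /(rescaled_max_lt _ _ _ n0 t0)/h; apply.
have PE n : (0 < n)%N ->
    P [set w | c <= rescaled_max (X ^~ w) (Y ^~ w) n t] = (1 - fine (P (A n)))%:E.
  move=> n0; rewrite E// probability_setC// EFinB fineK// fin_num_measure//.
apply/fine_cvgP; split.
  by exists 1%N => // n /= n0; rewrite PE.
apply/cvgrPdist_le => e e0; near=> n.
rewrite /= PE; last by near: n; exists 1%N.
rewrite opprB addrCA subrr addr0 ger0_norm ?fine_ge0//.
by near: n; exact: H.
Unshelve. all: by end_near. Qed.

(** * A continuous functional on D[0,1] and the absence of a weak limit *)

Definition clip {R : realType} (M z : R) : R := Num.min 1 (Num.max 0 (M + 1 - z)).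

(* A continuous substitute for the indicator of {sup x <= M}. Taking the infimum
   of the clipped values, rather than clipping the supremum, needs no
   boundedness of x. *)
Definition soft_below {R : realType} (M : R) (x : D01 R) : R :=
  inf [set clip M (x t) | t in [set: unit_itv R]].

Lemma clip_ge0 (R : realType) (M z : R) : 0 <= clip M z.
Proof. by rewrite le_min ler01/= le_max lexx. Qed.

Lemma clip_le1 (R : realType) (M z : R) : clip M z <= 1.
Proof. by rewrite ge_min lexx. Qed.

(** [clip M] is 1 up to M, 0 from M + 1 on, and has slope -1 in between: it is nonincreasing and
    1-Lipschitz. *)
Lemma clip_le (R : realType) (M y z r : R) : z <= y + r -> 0 <= r ->
  clip M y <= clip M z + r.
Proof.
have clipE u : clip M u = if M + 1 <= u then 0 else if M <= u then M + 1 - u else 1.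
  rewrite /clip; case: (leP (M + 1) u) => uM1.
    by rewrite max_l ?min_r//; lra.
  by case: (leP M u) => uM; rewrite max_r; [rewrite min_r|..|rewrite min_l|]; lra.
move=> zy r0; rewrite !clipE.
by case: (leP (M + 1) y); case: (leP M y); case: (leP (M + 1) z); case: (leP M z); lra.
Qed.

Lemma unit_itv_inhabited (R : realType) (s : R) : 0 <= s -> s <= 1 ->
  exists t : unit_itv R, val t = s.
Proof.
move=> s0 s1; have s01 : s \in (`[0, 1]%classic : set R).
  by rewrite inE/= in_itv/= s0.
by exists (exist _ s s01).
Qed.

Lemma soft_below_has_lbound (R : realType) (M : R) (x : D01 R) :
  has_lbound [set clip M (x t) | t in [set: unit_itv R]].
Proof. by exists 0 => z [t _ <-]; exact: clip_ge0. Qed.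

Lemma soft_below_set_nonempty (R : realType) (M : R) (x : D01 R) :
  [set clip M (x t) | t in [set: unit_itv R]] !=set0.
Proof.
have [t _] := @unit_itv_inhabited R 0 (lexx 0) ler01.
by exists (clip M (x t)), t.
Qed.

Lemma soft_below_ge0 (R : realType) (M : R) (x : D01 R) : 0 <= soft_below M x.
Proof.
apply: lb_le_inf; first exact: soft_below_set_nonempty.
by move=> z [t _ <-]; exact: clip_ge0.
Qed.

Lemma soft_below_lb (R : realType) (M : R) (x : D01 R) (t : unit_itv R) :
  soft_below M x <= clip M (x t).
Proof. by apply: ge_inf; [exact: soft_below_has_lbound | exists t]. Qed.

Lemma soft_below_le1 (R : realType) (M : R) (x : D01 R) : soft_below M x <= 1.
Proof.
have [t _] := @unit_itv_inhabited R 0 (lexx 0) ler01.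
exact: le_trans (soft_below_lb M x t) (clip_le1 _ _).
Qed.

Lemma soft_below_mono (R : realType) (M M' : R) (x : D01 R) : M <= M' ->
  soft_below M x <= soft_below M' x.
Proof.
move=> MM'; apply: lb_le_inf; first exact: soft_below_set_nonempty.
move=> z [t _ <-]; apply: le_trans (soft_below_lb M x t) _.
by rewrite /clip le_min2// ?lexx// le_max2// ?lexx// lerD2r lerD2r.
Qed.

(** The infimum runs over all times, so a time change is harmless: [y] at [lam t] is compared with
    [x] at [t], and [clip] is 1-Lipschitz. *)
Lemma soft_below_ball (R : realType) (M e : R) (x y : D01 R) :
  skorokhod_ball x e y -> soft_below M y < soft_below M x + e.
Proof.
move=> /skorokhod_ballP[r re [lam [_ _ xy]]].
have r0 : 0 <= r.
  have [t _] := @unit_itv_inhabited R 0 (lexx 0) ler01.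
  exact: le_trans (normr_ge0 _) (xy t).
apply: (@le_lt_trans _ _ (soft_below M x + r)); last by rewrite ltrD2l.
rewrite -lerBlDr; apply: lb_le_inf; first exact: soft_below_set_nonempty.
move=> z [t _ <-]; rewrite lerBlDr.
apply: le_trans (soft_below_lb M y (lam t)) _; apply: clip_le => //.
by have := xy t; rewrite ler_norml => /andP[_]; lra.
Qed.

Lemma soft_below_continuous (R : realType) (M : R) :
  continuous (soft_below M : D01 R -> R).
Proof.
move=> x; have FF : Filter (nbhs x) := nbhs_filter x.
apply/(cvgrPdist_lt (FF := FF)) => e e0.
have := nbhsx_ballx x e e0; apply: filterS => y xy.
have h1 := soft_below_ball M xy.
have h2 := soft_below_ball M (skorokhod_ball_sym xy).
by rewrite ltr_norml; apply/andP; split; lra.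
Qed.

(** The one-sided limits bound [x] near each point, and compactness of [0, 1] makes the bound
    uniform. *)
Lemma cadlag_bounded_above (R : realType) (x : D01 R) :
  exists M : R, forall t, x t <= M.
Proof.
have /compact_near_coveringP cov := @segment_compact R 0 1.
have [M [_ H]] : \forall M \near +oo, `[0, 1] `<=`
    (fun s : R => forall u : unit_itv R, val u = s -> x u <= M).
  apply: cov => s /=; rewrite in_itv/= => /andP[s0 s1].
  have [t ts] := unit_itv_inhabited s0 s1.
  have [xr [l xl]] := D01P x t.
  have /cvgrPdist_lt/(_ 1 ltr01) := xr; rewrite near_withinE => /nbhs_unit_itvP[e1 e10 H1].
  have /cvgrPdist_lt/(_ 1 ltr01) := xl; rewrite near_withinE => /nbhs_unit_itvP[e2 e20 H2].
  near=> s' M => /= u us'.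
  have d1 : `|s - s'| < Num.min e1 e2.
    by near: s'; apply: cvgr_dist_lt => //; rewrite lt_min e10.
  move: d1; rewrite lt_min -ts -us' => /andP[d1 d2].
  have [tu|ut] := leP (val t) (val u).
    have := H1 u d1 tu; rewrite /= ltr_norml => /andP[h _].
    apply: (@le_trans _ _ (x t + 1)); first by rewrite ltW//; lra.
    near: M; apply: nbhs_pinfty_ge; exact: num_real.
  have := H2 u d2 ut; rewrite /= ltr_norml => /andP[h _].
  apply: (@le_trans _ _ (l + 1)); first by rewrite ltW//; lra.
  near: M; apply: nbhs_pinfty_ge; exact: num_real.
exists (M + 1) => t; apply: (H (M + 1)) => //; first lra.
by rewrite /= in_itv/= unit_itv_ge0 unit_itv_le1.
Unshelve. all: by end_near. Qed.

Lemma measurable_soft_below (R : realType) (M : R) :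
  measurable_fun setT
    (soft_below M : g_sigma_algebraType (@open (D01 R)) -> R).
Proof.
apply: (measurability _ (RGenOInfty.measurableE R)) => _ [_ [x ->] <-].
rewrite setTI; apply: sub_sigma_algebra.
apply: (@open_comp (D01 R) R); last exact: interval_open.
by move=> y _; apply: soft_below_continuous.
Qed.

(** The integral of a nonnegative function is a supremum over the simple functions below it, which
    is plainly monotone. This serves for the maps [X n] into [D01], about which
    [not_converges_weakly] assumes no measurability. *)
Lemma ge0_le_integral_nomeas (R : realType) (d : measure_display)
    (T : measurableType d) (mu : measure T R) (f g : T -> \bar R) :
  (forall x, 0 <= f x)%E -> (forall x, f x <= g x)%E ->
  (\int[mu]_x f x <= \int[mu]_x g x)%E.
Proof.
move=> f0 fg; rewrite !ge0_integralTE//; last first.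
  by move=> x; exact: le_trans (f0 x) (fg x).
apply: ge_ereal_sup => _ [h hf <-]; apply: ereal_sup_ubound; exists h => //.
by move=> x; exact: le_trans (hf x) (fg x).
Qed.

(** Testing a limit [mu] against [soft_below M] gives integral 0 for every M > 0. As M grows these
    functions increase to 1, since each path is bounded above, so monotone convergence forces [mu]
    to have mass 0. *)
Lemma not_converges_weakly (R : realType) (d : measure_display)
    (T : measurableType d) (P : probability T R) (X : nat -> T -> D01 R) :
  (forall M e : R, 0 < M -> 0 < e ->
    \forall n \near \oo, exists A : set T, [/\ measurable A,
      forall w, ~ A w -> soft_below M (X n w) = 0 & fine (P A) <= e]) ->
  ~ exists mu : probability (g_sigma_algebraType (@open (D01 R))) R,
      converges_weakly P X mu.
Proof.
move=> H [mu Xmu].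
have I0 (M : R) : 0 < M -> (\int[mu]_x (soft_below M x)%:E = 0)%E.
  move=> M0.
  have bd : exists B : R, forall x : D01 R, `|soft_below M x| <= B.
    by exists 1 => x; rewrite ger0_norm ?soft_below_ge0// soft_below_le1.
  have HM := Xmu _ (@soft_below_continuous R M) bd.
  apply/eqP; rewrite eq_le; apply/andP; split; last first.
    by apply: integral_ge0 => x _; rewrite lee_fin soft_below_ge0.
  apply/lee_addgt0Pr => e e0; rewrite add0e -(cvg_lim _ HM)//.
  apply: lime_le; first by apply/cvg_ex; eexists; exact: HM.
  near=> n.
  have [A [mA XA PA]] : exists A : set T, [/\ measurable A,
      forall w, ~ A w -> soft_below M (X n w) = 0 & fine (P A) <= e].
    by near: n; exact: H.
  apply: (@le_trans _ _ (P A)); last first.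
    have -> : P A = (fine (P A))%:E by rewrite fineK// fin_num_measure.
    by rewrite lee_fin.
  have <- : (\int[P]_w (\1_A w)%:E)%E = P A by rewrite integral_indic// setIT.
  rewrite unlock; apply: ge0_le_integral_nomeas => w; rewrite lee_fin.
    exact: soft_below_ge0.
  rewrite indicE; case: (boolP (w \in A)) => [_|/negP wA].
    exact: soft_below_le1.
  by rewrite XA// => Aw; apply: wA; rewrite inE.
have mcv : (\int[mu]_x (soft_below m.+1%:R x)%:E)%E @[m --> \oo] -->
    (\int[mu]_x limn (fun m => (soft_below m.+1%:R x)%:E))%E.
  apply: cvg_monotone_convergence => //.
  - by move=> m; apply/measurable_EFinP; exact: measurable_soft_below.
  - by move=> m x _; rewrite lee_fin soft_below_ge0.
  - move=> x _ m n mn; rewrite lee_fin; apply: soft_below_mono.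
    by rewrite ler_nat ltnS.
have lim1 (x : D01 R) : limn (fun m => (soft_below m.+1%:R x)%:E) = 1%E.
  have [B xB] := cadlag_bounded_above x.
  apply/cvg_lim => //; apply: cvg_near_cst; near=> m.
  congr EFin; apply/eqP; rewrite eq_le soft_below_le1/=.
  apply: lb_le_inf; first exact: soft_below_set_nonempty.
  move=> z [t _ <-]; rewrite /clip le_min lexx le_max; apply/orP; right.
  have Bm : B <= m.+1%:R.
    apply: (@le_trans _ _ m%:R); last by rewrite ler_nat.
    by near: m; exact: nbhs_infty_ger.
  by have := xB t; lra.
move: mcv; under eq_integral do rewrite lim1.
under eq_fun do rewrite I0 ?ltr0Sn//.
have := expectation_cst mu 1; rewrite unlock => ->.
move=> /cvg_lim => /(_ (@ereal_hausdorff R)); rewrite lim_cst// => /eqP.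
by rewrite eq_sym onee_eq0.
Unshelve. all: by end_near. Qed.

(** A single visit of the rescaled walk to [M + 1, +oo[, where [clip M] vanishes, makes the infimum
    0; the visit at step k occurs at time k / n. *)
Lemma soft_below_rescaled_walk (R : realType) (x y : nat -> R) (n : nat) (M : R) :
  (0 < n)%N ->
  ~ (forall k, (k <= Num.truncn (n%:R * 1 : R))%N ->
      walk x y k < (M + 1) * Num.sqrt n%:R) ->
  soft_below M (rescaled_walk x y n) = 0.
Proof.
move=> n0; rewrite mulr1 natrK => /existsNP[k /not_implyP[kn /negP]].
rewrite -leNgt => wk.
have n0' : 0 < n%:R :> R by rewrite ltr0n.
have [|t tk] := @unit_itv_inhabited R (k%:R / n%:R) (divr_ge0 (ler0n _ _) (ler0n _ _)).
  by rewrite ler_pdivrMr// mul1r ler_nat.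
apply/eqP; rewrite eq_le soft_below_ge0 andbT.
apply: le_trans (soft_below_lb M _ t) _.
have nk : n%:R * (k%:R / n%:R) = k%:R :> R by rewrite mulrC divfK// gt_eqF.
rewrite /clip /= tk /walk_at nk natrK.
have : M + 1 <= walk x y k / Num.sqrt n%:R by rewrite ler_pdivlMr// sqrtr_gt0.
by move=> h; rewrite max_l ?ge_min ?lexx ?orbT// lerBlDr add0r.
Qed.

Theorem theorem2 (R : realType) (d : measure_display) (T : measurableType d)
    (P : probability T R) (xi eta : nat -> {RV P >-> R}) (sigma : R)
    (l : R -> R)
    (xi_iid : iid xi) (eta_iid : iid eta)
    (xi_eta_indep : independent_sequences xi eta)
    (xi_mean : 'E_P[xi 0%N]%E = 0%E)
    (sigma_gt0 : 0 < sigma)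
    (xi_moment2 : 'E_P[fun w => (xi 0%N w ^+ 2)%R]%E = (sigma ^+ 2)%:E)
    (eta_gt0 : forall n, {ae P, forall w, 0 < eta n w})
    (l_sv : slowly_varying l)
    (eta_tail : fine (ccdf (eta 0%N) x) / l x @[x --> +oo] --> (1 : R)) :
  (~ exists mu : probability (g_sigma_algebraType (@open (D01 R))) R,
      converges_weakly P
        (fun n w => rescaled_walk (xi ^~ w) (eta ^~ w) n) mu) /\
  (forall t : R, 0 < t -> forall c : R, 0 < c ->
    P [set w | c <= rescaled_max (xi ^~ w) (eta ^~ w) n t]
      @[n --> \oo] --> 1%E).
Proof.
have below_cvg0 (t c e : R) (t0 : 0 < t) (c0 : 0 < c) (e0 : 0 < e) :=
  walk_below_cvg0 xi_iid eta_iid xi_eta_indep xi_mean sigma_gt0 xi_moment2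
    eta_gt0 l_sv eta_tail t0 c0 e0.
split=> [|t t0 c c0]; last first.
  by apply: rescaled_max_ge_cvg1 => [|e e0]; [exact: ltW | exact: below_cvg0].
apply: not_converges_weakly => M e M0 e0.
have M10 : 0 < M + 1 by lra.
(* The first claim needs only the horizon t = 1, with the level M + 1 at which [clip M] reaches
   0. *)
have H := below_cvg0 1 (M + 1) e ltr01 M10 e0.
near=> n; exists [set w | forall k, (k <= Num.truncn (n%:R * 1 : R))%N ->
  walk (xi ^~ w) (eta ^~ w) k < (M + 1) * Num.sqrt n%:R]; split.
- exact: measurable_walk_below.
- by move=> w; apply: soft_below_rescaled_walk; near: n; exists 1%N.
- by near: n; exact: H.
Unshelve. all: by end_near. Qed.
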